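(* Fix $x\ge 0$ and a sequence $(k_n)_{n\ge 1}$ of integers with $1\le k_n\le n$ and $2k_n/\sqrt{n}\to x$ as $n\to\infty$. For each $n$, let $\mathfrak{f}^{(n)}$ be a rooted forest on the vertex set $[n]=\{1,\dots,n\}$ with $k_n$ roots, chosen uniformly among all such forests. Then, as $n\to\infty$, $$\frac{1}{2 n^{3/2} } \sum_{v\in \mathfrak{f}^{(n)}} \operatorname{ht}(v) - \frac{1}{n^{3/2}} \sum_{v\in \mathfrak{f}^{(n)}} \operatorname{csn}(v) \;\Longrightarrow\; \mathscr{N}\left(-\frac{x}{4} , \frac{1}{12} \right)$$ in distribution, where $\mathscr{N}(m,\sigma^2)$ is the normal law with mean $m$ and variance $\sigma^2$.
   Context: A forest on $[n]$ is a cycle-free graph with vertex set $[n]$. It is rooted if each connected component has one distinguished vertex, its root (so the number of roots is the number of components). Let $\operatorname{dist}$ be the graph distance. For a vertex $v$ lying in the component with root $\rho$, the height of $v$ is $\operatorname{ht}(v)=\operatorname{dist}(v,\rho)$, and its number of cousins is $\operatorname{csn}(v)=\#\{w\in\mathfrak{f}:\operatorname{ht}(w)=\operatorname{ht}(v),\ w\ne v\}$, where $w$ ranges over all vertices of the whole forest $\mathfrak{f}$ (not only the component of $v$). The sums run over all vertices of $\mathfrak{f}^{(n)}$. *)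

(* Defs.v *)
From HB Require Import structures.
From mathcomp Require Export all_boot all_order all_algebra.
From mathcomp Require Export all_classical all_reals all_analysis.
Export numFieldNormedType.Exports.

Set Implicit Arguments.
Unset Strict Implicit.
Unset Printing Implicit Defensive.

Import Order.TTheory GRing.Theory Num.Theory.

Section graph_distance.
Variables (T : finType) (e : rel T).

(* The length of a shortest path from x to y; the junk value #|T|, larger than
   any actual distance, is returned when y is not reachable from x. *)
Definition dist (x y : T) : nat :=
  find (fun m => [exists p : m.-tuple T, path e x p && (last x p == y)])
       (iota 0 #|T|).

(* A cycle is a closed path through at least three pairwise distinct vertices;
   the bound excludes x - y - x, which traverses a single edge twice. *)
Definition cycle_free : Prop :=
  forall p : seq T, (2 < size p)%N -> uniq p -> ~~ cycle e p.

End graph_distance.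

Section rooted_forests.
Variable n : nat.

(* A simple graph on 'I_n (vertex i standing for i + 1 in {1, ..., n}) is given
   by its set of edges, each a set of two vertices. *)
Definition adj (E : {set {set 'I_n}}) : rel 'I_n :=
  fun x y => ([set x; y]%SET \in E).

Definition is_rooted_forest (G : {set {set 'I_n}} * {set 'I_n}) : bool :=
  [&& [forall (e | e \in G.1), #|e| == 2],
      `[< cycle_free (adj G.1) >] &
      [forall v, #|[set r in G.2 | connect (adj G.1) v r]%SET| == 1]].

Record rooted_forest := RootedForest {
  forest_pair : {set {set 'I_n}} * {set 'I_n};
  _ : is_rooted_forest forest_pair }.

HB.instance Definition _ := [isSub for forest_pair].
HB.instance Definition _ := [Finite of rooted_forest by <:].

Definition edges (F : rooted_forest) : {set {set 'I_n}} := (forest_pair F).1.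
Definition roots (F : rooted_forest) : {set 'I_n} := (forest_pair F).2.

(* The default v is never used: v is connected to exactly one root. *)
Definition root_of (F : rooted_forest) (v : 'I_n) : 'I_n :=
  odflt v [pick r in roots F | connect (adj (edges F)) v r].

Definition ht (F : rooted_forest) (v : 'I_n) : nat :=
  dist (adj (edges F)) v (root_of F v).

Definition csn (F : rooted_forest) (v : 'I_n) : nat :=
  #|[set w | (ht F w == ht F v) && (w != v)]%SET|.

(* The edgeless graph in which every vertex is a root. *)
Lemma edgeless_subproof :
  is_rooted_forest (finset.set0, finset.setTfor 'I_n).
Proof.
apply/and3P; split => /=.
- by apply/forallP => e; rewrite finset.in_set0.
- apply/asboolP => -[//|x [//|y p]] _ _ /=.
  by rewrite /adj finset.in_set0.
- apply/forallP => v; apply/eqP; rewrite -(cards1 v); congr #|pred_of_set _|.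
  apply/setP => r; rewrite finset.in_set finset.in_set1 finset.in_setT /=.
  apply/connectP/eqP => [[[|y p] /=]|->].
  + by move=> _ ->.
  + by rewrite {1}/adj finset.in_set0.
  + by exists [::].
Qed.

HB.instance Definition _ :=
  isPointed.Build rooted_forest (RootedForest edgeless_subproof).
HB.instance Definition _ := @isMeasurable.Build default_measure_display
  rooted_forest discrete_measurable discrete_measurable0
  discrete_measurableC discrete_measurableU.

End rooted_forests.

Local Open Scope classical_set_scope.
Local Open Scope ring_scope.

Definition height_cousin_stat (R : realType) (n : nat) (F : rooted_forest n) : R :=
  1 / (2 * n%:R `^ (3 / 2)) * \sum_(v < n) (ht F v)%:R
  - 1 / (n%:R `^ (3 / 2)) * \sum_(v < n) (csn F v)%:R.

Lemma measurable_height_cousin_stat (R : realType) (n : nat) :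
  measurable_fun setT (@height_cousin_stat R n).
Proof. by []. Qed.

HB.instance Definition _ (R : realType) (n : nat) :=
  isMeasurableFun.Build _ _ _ _ (@height_cousin_stat R n)
    (@measurable_height_cousin_stat R n).

Definition uniformly_distributed (R : realType) (d : measure_display)
    (T : measurableType d) (P : probability T R) (n : nat)
    (f : {RV P >-> rooted_forest n}) (S : {set rooted_forest n}) : Prop :=
  forall F : rooted_forest n,
    distribution P f [set F] = (if F \in S then (#|S|%:R)^-1 else 0)%:E.

Definition cvg_in_distribution (R : realType) (d : nat -> measure_display)
    (T : forall n, measurableType (d n)) (P : forall n, probability (T n) R)
    (X : forall n, {RV (P n) >-> R})
    (nu : probability (measurableTypeR R) R) : Prop :=
  forall g : R -> R, continuous g -> bounded_fun g ->
    ('E_(P n)[g \o X n] @[n --> \oo] --> 'E_nu[g])%E.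

(* Main.v *)
Require Import Defs.
From mathcomp Require Import measurable_realfun lebesgue_integral_under.
From mathcomp Require Import ring lra zify.

(** Only the profile of the forest matters, that is, the sequence
[Z_0 = k, Z_1, Z_2, ...] of its generation sizes.  Once the generations are
known, each non-root chooses its parent freely in the previous one, so that a
uniform forest has a given sequence of generations with probability
proportional to the product of the [Z_h ^ Z_(h+1)].  Summing from the last
generation to the first yields a Markov chain: if the current generation has
[m] vertices and [M > 0] vertices lie below it, then the next one has [1 + b]
vertices, with [b] binomial of parameters [M - 1] and [m / (m + M)]
([sum_forests_levels], [sum_levels], [gen_sum_chainE]).

Let [Z] be the next generation and [M' = M - Z].  The product of the size of a
generation with the number of vertices below it satisfies
[M' Z - M m + Z^2 + m Z = M + (m + M) xi], where [xi] is [Z] minus its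
conditional mean.  The sum of [M] over all generations is the total height and
the sum of the [Z^2] is essentially the number of cousins.  Since
[2 m Z = m^2 + Z^2 - (Z - m)^2], summing this relation over the generations
shows that half the total height minus the number of cousins is
[- k (n - k) / 2], minus half of a martingale with increments
[(m + M) xi], up to terms of smaller order ([height_square_sum]).  The first
term, divided by [n^(3/2)], tends to [- x / 4].

The conditional variance of the increment is exactly [M (M - 1) m], and the sum
of these is close to the telescoping sum of the [((m + M)^3 - M^3) / 3], which
is [n^3 / 3] ([variation_bounds]).  So the total conditional variance
of the normalised martingale is asymptotically deterministic, equal to
[1 / 4 * 1 / 3 = 1 / 12], and its law is asymptotically normal.  This is proved
by computing means of cosines: multiplied by the exponential of half the
conditional variance, the cosine of the martingale keeps its mean, up to an
error controlled by the third and fourth moments ([chain_cos]).  The error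
terms are all controlled by the sum of the [Z^2], which has mean of order
[n^(3/2)] because the conditional mean of [Z^2] is at most
[m^2 + 3 m + 1 - m^3 / (m + M)] ([chainE_cube_sum], [mean_square]).

Finally, convergence of the means of all cosines together with tightness gives
convergence in distribution: on a bounded interval a continuous function is
uniformly close to a Bernstein polynomial in a sine, which stays bounded outside
of it ([trig_approx], [cvg_mean_of_cos]).  The cosines of the normal law are
obtained from Stein's identity, which is a differential equation for them
([Rintegral_cos_normal_pdf]). *)

Set Implicit Arguments.
Unset Strict Implicit.
Unset Printing Implicit Defensive.
Import Order.TTheory GRing.Theory Num.Theory.

(** * Shortest paths in a finite graph *)

Section dist_theory.
Variables (T : finType) (e : rel T).

(** This includes long paths: those of size at least [#|T|] are no shorter than even the junk
value of [dist]. *)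
Lemma dist_le (x y : T) (p : seq T) :
  path e x p -> last x p = y -> dist e x y <= size p.
Proof.
move=> pp lp; rewrite /dist leqNgt; apply/negP => lt.
have sT : size p < #|T|.
  apply: leq_trans lt _; rewrite -[X in _ <= X](size_iota 0); exact: find_size.
have := before_find 0 lt; rewrite nth_iota// add0n.
by move=> /negbT/existsPn/(_ (in_tuple p)); rewrite /= pp lp eqxx.
Qed.

Lemma dist_path (x y : T) : dist e x y < #|T| ->
  exists p, [/\ path e x p, last x p = y & size p = dist e x y].
Proof.
move=> lt; have := lt; rewrite /dist -{2}(size_iota 0 #|T|) -has_find.
move/(nth_find 0); rewrite nth_iota ?add0n//.
case/existsP => p /andP[pp /eqP lp]; exists p; split => //.
by rewrite size_tuple.
Qed.

Lemma dist_lt (x y : T) : connect e x y -> dist e x y < #|T|.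
Proof.
case/connectP => p /shortenP[q pq uq _] ->.
apply: leq_ltn_trans (dist_le pq erefl) _.
have := max_card (mem (x :: q)).
by move/card_uniqP: uq => ->.
Qed.

Lemma dist_xx (x : T) : dist e x x = 0.
Proof. by apply/eqP; rewrite -leqn0; apply: (@dist_le x x [::]). Qed.

Lemma dist_eq0 (x y : T) : connect e x y -> dist e x y = 0 -> x = y.
Proof.
move=> c d0; have [p [pp lp]] := dist_path (dist_lt c).
by rewrite d0; case: p pp lp.
Qed.

Lemma dist_step (x y r : T) :
  connect e y r -> e x y -> dist e x r <= (dist e y r).+1.
Proof.
move=> c exy; have [p [pp lp <-]] := dist_path (dist_lt c).
by apply: (@dist_le x r (y :: p)); rewrite //= exy.
Qed.

Lemma dist_pred (x r : T) : connect e x r -> 0 < dist e x r ->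
  exists y, [/\ e x y, connect e y r & dist e x r = (dist e y r).+1].
Proof.
move=> c; have [[|y p] [/= pp lp sp]] := dist_path (dist_lt c); rewrite -sp => // _.
case/andP: pp => exy pp.
have cy : connect e y r by apply/connectP; exists p.
exists y; split => //; congr _.+1; apply/eqP.
rewrite eqn_leq (dist_le pp lp) andbT -ltnS.
by rewrite sp; exact: dist_step.
Qed.
End dist_theory.

(** * Heights and parents in a rooted forest *)

Section forest_theory.
Variables (n : nat) (F : rooted_forest n).
Implicit Types (v w a b : 'I_n) (s : seq 'I_n).
Local Notation e := (adj (edges F)).

Lemma adj_sym (E : {set {set 'I_n}}) : symmetric (adj E).
Proof. by move=> x y; rewrite /adj finset.setUC. Qed.

Lemma forest_edge_card (ed : {set 'I_n}) : ed \in edges F -> #|ed| = 2.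
Proof.
case: F => [[E Rt] /= H]; case/and3P: (H) => /= /forallP/(_ ed)/implyP Hc _ _.
by move=> /Hc/eqP.
Qed.

Lemma forest_cycle_free : cycle_free e.
Proof. by case: F => [[E Rt] /= H]; case/and3P: (H) => /= _ /asboolP. Qed.

Lemma adj_irrefl v : e v v = false.
Proof.
apply/negP => /forest_edge_card; rewrite finset.setUid cards1 => /eqP //.
Qed.

Lemma forest_rootP v : exists r, forall w,
  ((w \in roots F) && connect e v w) = (w == r).
Proof.
case: F => [[E Rt] /= H]; case/and3P: (H) => /= _ _ /forallP/(_ v).
case/cards1P => r Hr; exists r => w; rewrite /roots /edges /=.
by move/setP/(_ w): Hr; rewrite !inE.
Qed.

Lemma root_ofP v :
  (forall w, ((w \in roots F) && connect e v w) = (w == root_of F v)).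
Proof.
have [r Hr] := forest_rootP v; rewrite /root_of.
case: pickP => [x Hx|H0] /=; last by have := H0 r; rewrite Hr eqxx.
by move: Hx; rewrite Hr => /eqP ->.
Qed.

Lemma root_of_root v : root_of F v \in roots F.
Proof. by have := root_ofP v (root_of F v); rewrite eqxx => /andP[]. Qed.

Lemma connect_root_of v : connect e v (root_of F v).
Proof. by have := root_ofP v (root_of F v); rewrite eqxx => /andP[]. Qed.

Lemma connect_adj_sym : connect_sym e.
Proof. exact/sym_connect_sym/adj_sym. Qed.

Lemma root_of_connect v w : connect e v w -> root_of F v = root_of F w.
Proof.
move=> c; apply/eqP; rewrite -root_ofP root_of_root /=.
by apply: connect_trans (connect_root_of v); rewrite connect_adj_sym.
Qed.

Lemma ht_lt v : ht F v < n.
Proof. by rewrite -[X in _ < X]card_ord; exact/dist_lt/connect_root_of. Qed.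

Lemma ht_eq0 v : (ht F v == 0) = (v \in roots F).
Proof.
apply/eqP/idP => [/(dist_eq0 (connect_root_of v)) ->|rv].
  exact: root_of_root.
have /eqP vr : v == root_of F v by rewrite -root_ofP rv connect0.
by rewrite /ht -vr dist_xx.
Qed.

Lemma ht_adj v w : e v w -> ht F v <= (ht F w).+1.
Proof.
move=> evw; rewrite /ht (root_of_connect (connect1 evw)).
by apply: dist_step => //; exact: connect_root_of.
Qed.

Definition parent v : 'I_n :=
  odflt v [pick w | e v w && (ht F v == (ht F w).+1)].

Lemma parentP v : 0 < ht F v -> e v (parent v) /\ ht F v = (ht F (parent v)).+1.
Proof.
move=> h0; rewrite /parent; case: pickP => [w /andP[evw /eqP//]|H0].
have [w [evw cw hw]] := dist_pred (connect_root_of v) h0.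
have := H0 w; rewrite evw {2}/ht -(root_of_connect (connect1 evw)) -hw.
by rewrite eqxx.
Qed.

(** Following parents from two vertices of equal height until the lines of
descent merge gives a simple path that stays below its endpoints. *)
Lemma descent_path h a b : ht F a = h -> ht F b = h -> a != b ->
    connect e a b ->
  exists s, [/\ path e a s, last a s = b, uniq (a :: s), 1 < size s
    & all (fun w => ht F w <= h) (a :: s)].
Proof.
elim: h a b => [|h IH] a b ha hb ab cab.
  move/eqP: ha; rewrite ht_eq0 => ra; move/eqP: hb; rewrite ht_eq0 => rb.
  have /eqP Ea : a == root_of F a by rewrite -root_ofP ra connect0.
  have /eqP Eb : b == root_of F b by rewrite -root_ofP rb connect0.
  by rewrite Ea Eb (root_of_connect cab) eqxx in ab.
have [ea] := @parentP a ltac:(by rewrite ha).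
have [eb] := @parentP b ltac:(by rewrite hb).
set a' := parent a in ea *; set b' := parent b in eb *.
rewrite ha hb => -[hb'] [ha'].
have eb2 : e b' b by rewrite adj_sym.
have naa w : ht F w <= h -> (w != a) && (w != b).
  by move=> hw; apply/andP; split; apply/eqP => Ew; move: hw; rewrite Ew ?ha ?hb ltnn.
have [E|ab'] := eqVneq a' b'.
  have /andP[a'a a'b] := naa a' (eq_leq (esym ha')).
  exists [:: a'; b]; split => //=.
  - by rewrite ea E eb2.
  - by rewrite !inE (eq_sym a) (negbTE a'a) (negbTE ab) a'b.
  - by rewrite ha hb -ha' leqnn leqnSn.
have [|s [ps ls us ss hs]] := IH a' b' (esym ha') (esym hb') ab'.
  apply: connect_trans (connect1 eb); apply: connect_trans cab.
  by apply: connect1; rewrite adj_sym.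
exists (a' :: rcons s b); split => //.
- by rewrite /= ea rcons_path ps ls.
- by rewrite /= last_rcons.
- have nin w : w \in a' :: s -> (w != a) && (w != b).
    by move=> wi; apply: naa; exact: (allP hs).
  rewrite -rcons_cons -rcons_cons rcons_uniq cons_uniq us andbT; apply/andP; split.
    rewrite inE negb_or eq_sym ab /=; apply/negP => /nin.
    by rewrite eqxx andbF.
  by apply/negP => /nin; rewrite eqxx.
- by rewrite /= size_rcons.
- have := sub_all (fun w => @leqW (ht F w) h) hs.
  by rewrite /= all_rcons ha hb leqnn.
Qed.

(** An edge inside a generation would close the path of [descent_path] into a
cycle. *)
Lemma adj_ht_neq a b : e a b -> ht F a != ht F b.
Proof.
move=> eab; apply/eqP => hab.
have ab : a != b by apply/eqP => E; move: eab; rewrite E adj_irrefl.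
have [s [ps ls us ss _]] := descent_path erefl (esym hab) ab (connect1 eab).
have /negP := @forest_cycle_free (a :: s) ss us; apply.
by rewrite /cycle rcons_path ps ls adj_sym.
Qed.

(** Two parents of [v] would be joined by a path that stays below [v], which
[v] closes into a cycle. *)
Lemma parent_uniq v a b : e v a -> e v b ->
  ht F v = (ht F a).+1 -> ht F v = (ht F b).+1 -> a = b.
Proof.
move=> eva evb hva hvb; apply/eqP; apply/negPn/negP => ab.
have hab : ht F b = ht F a by apply/eqP; rewrite -eqSS -hva -hvb.
have cab : connect e a b.
  by apply: connect_trans (connect1 evb); apply: connect1; rewrite adj_sym.
have [s [ps ls us ss hs]] := descent_path erefl hab ab cab.
have vs : v \notin a :: s.
  by apply/negP => /(allP hs); rewrite hva ltnn.
have uv : uniq (v :: a :: s) by rewrite cons_uniq vs.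
have /negP := @forest_cycle_free (v :: a :: s) (leqW ss) uv; apply.
by rewrite /= eva rcons_path ps ls adj_sym.
Qed.

Lemma parent_eq v w : e v w -> ht F v = (ht F w).+1 -> parent v = w.
Proof.
move=> evw hv; have [evp hp] := @parentP v ltac:(by rewrite hv).
exact: parent_uniq evp evw hp hv.
Qed.

(** The heights of the ends of an edge differ by one, so that the lower end is
the parent of the upper one; hence the forest is determined by its parent map. *)
Lemma edgesE : edges F = [set [set v; parent v]%SET | v in [set v | 0 < ht F v]]%SET.
Proof.
apply/setP => E; apply/idP/imsetP => [EF|[v]]; last first.
  by rewrite inE => /parentP[evp _] ->.
have /eqP/cards2P[x [y [xy Exy]]] := forest_edge_card EF.
have exy : e x y by rewrite /adj -Exy.
have eyx : e y x by rewrite adj_sym.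
have := adj_ht_neq exy; rewrite neq_ltn => /orP[lt|lt].
  have hy : ht F y = (ht F x).+1 by apply/eqP; rewrite eqn_leq ht_adj.
  by exists y; rewrite ?inE ?hy// (parent_eq eyx hy) finset.setUC.
have hx : ht F x = (ht F y).+1 by apply/eqP; rewrite eqn_leq ht_adj.
by exists x; rewrite ?inE ?hx// (parent_eq exy hx).
Qed.

Lemma rootsE : roots F = [set v | ht F v == 0]%SET.
Proof. by apply/setP => v; rewrite inE ht_eq0. Qed.

End forest_theory.

(** * Forests as levels together with parent choices *)

Section forest_of_parents.
Variables (n : nat) (l : 'I_n -> nat) (p : 'I_n -> 'I_n).
Hypothesis l_le : forall v, l v <= n.
Hypothesis lp : forall v, 0 < l v -> l v = (l (p v)).+1.

Definition parent_edges : {set {set 'I_n}} :=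
  [set [set v; p v]%SET | v in [set v | 0 < l v]]%SET.
Definition level0 : {set 'I_n} := [set v | l v == 0]%SET.
Local Notation e := (adj parent_edges).

Lemma adj_parentP x y :
  reflect ((0 < l x /\ y = p x) \/ (0 < l y /\ x = p y)) (e x y).
Proof.
apply: (iffP imsetP) => [[v]|[[h ->]|[h ->]]]; last 2 first.
- by exists x; rewrite ?inE.
- by exists y; rewrite ?inE // finset.setUC.
rewrite inE => h E.
have vp : v != p v.
  by apply/eqP => E1; have := lp h; rewrite -E1; exact: n_Sn.
have := set21 x y; have := set22 x y; rewrite E !inE.
have := set21 v (p v); have := set22 v (p v); rewrite -E !inE.
move=> pvE vE /orP[]/eqP Ey /orP[]/eqP Ex; subst x y; [|by right|by left|].
  by move: pvE; rewrite orbb eq_sym (negbTE vp).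
by move: vE; rewrite orbb (negbTE vp).
Qed.

Let rt v := iter (l v) p v.

Lemma rt_parent v : 0 < l v -> rt v = rt (p v).
Proof. by move=> h; rewrite /rt (lp h) iterSr. Qed.

Lemma rt_root v : l (rt v) = 0 /\ connect e v (rt v).
Proof.
move E : (l v) => h; elim: h v E => [|h IH] v E.
  by rewrite /rt E /= E; split => //; exact: connect0.
have h0 : 0 < l v by rewrite E.
have [|r0 c] := IH (p v); first by apply/eqP; rewrite -eqSS -lp ?E.
rewrite rt_parent//; split => //; apply: connect_trans c.
by apply/connect1/adj_parentP; left.
Qed.

Lemma rt_connect v w : connect e v w -> rt v = rt w.
Proof.
case/connectP => s + ->; elim: s v => //= y s IH v /andP[/adj_parentP evy /IH <-].
by case: evy => -[h ->]; rewrite (rt_parent h).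
Qed.

(** Levels change by one along each edge. *)
Lemma level_path x s : path e x s -> l x <= l (last x s) + size s.
Proof.
elim: s x => [|y s IH] x /=; first by rewrite addn0.
case/andP => /adj_parentP exy /IH h; rewrite addnS.
case: exy => -[h0 E]; first by rewrite (lp h0) -E.
by apply: leq_trans (leqW h); rewrite E (lp h0) ltnW.
Qed.

Lemma level_path_ex v :
  exists s, [/\ path e v s, last v s = rt v & size s = l v].
Proof.
move E : (l v) => h; elim: h v E => [|h IH] v E.
  by exists [::]; rewrite /rt E.
have h0 : 0 < l v by rewrite E.
have [|s [ps ls ss]] := IH (p v); first by apply/eqP; rewrite -eqSS -lp ?E.
exists (p v :: s); rewrite /= ps ls ss (rt_parent h0); split => //.
by rewrite andbT; apply/adj_parentP; left.
Qed.

(** On a cycle, a vertex of maximal level has two distinct neighbours, both of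
which would be its parent. *)
Lemma parent_edges_cycle_free : cycle_free e.
Proof.
move=> s s3 us; apply/negP => cs.
have [x0 x0s] : exists x, x \in s by case: s s3 us cs => // x s; exists x; rewrite inE eqxx.
pose x := [arg max_(x > x0 in s) l x].
have [xs xmax] : x \in s /\ {in s, forall y, l y <= l x}.
  by rewrite /x; case: arg_maxnP.
have [i s' E] := rot_to xs.
have s'3 : 2 < size (x :: s') by rewrite -E size_rot.
have us' : uniq (x :: s') by rewrite -E rot_uniq.
have cs' : cycle e (x :: s') by rewrite -E rot_cycle.
have max' : {in s', forall y, l y <= l x}.
  by move=> y ys; apply: xmax; rewrite -(mem_rot i) E inE ys orbT.
case: s' {E} s'3 us' cs' max' => // y s' s'3 us' cs' max'.
move: cs'; rewrite /= rcons_path => /and3P[exy _ ezx].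
have par z : z \in y :: s' -> e x z -> z = p x.
  move=> /max' zx /adj_parentP[[]//|[h Ez]].
  by move: zx; rewrite Ez (lp h) ltnn.
have Ey : y = p x by apply: par => //; rewrite inE eqxx.
have Ez : last y s' = p x.
  apply: par; first exact: mem_last.
  by rewrite (adj_sym _ x).
case/lastP: s' s'3 us' Ez {ezx max' par} => // s' z _ us'.
rewrite last_rcons -Ey => E; move: us'; rewrite E /= mem_rcons inE eqxx.
by rewrite andbF.
Qed.

Lemma is_rooted_forest_parents : is_rooted_forest (parent_edges, level0).
Proof.
apply/and3P; split => /=.
- apply/forallP => E; apply/implyP => /imsetP[v]; rewrite inE => h ->.
  rewrite cards2; suff -> : v != p v by [].
  by apply/eqP => E1; have := lp h; rewrite -E1; exact: n_Sn.
- exact/asboolP/parent_edges_cycle_free.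
apply/forallP => v; apply/cards1P; exists (rt v); apply/setP => w.
have [r0 c] := rt_root v.
rewrite !inE; apply/andP/eqP => [[/eqP w0 /rt_connect ->]|->].
  by rewrite /rt w0.
by rewrite r0.
Qed.

Definition forest_of_parents := RootedForest is_rooted_forest_parents.

(** The line of descent is a shortest path to the root by [level_path]. A level
equal to [n] agrees with the junk value of [dist]. *)
Lemma ht_forest_of_parents v : ht forest_of_parents v = l v.
Proof.
have [r0 c] := rt_root v.
have /eqP E : rt v == root_of forest_of_parents v.
  by rewrite -root_ofP !inE r0 eqxx.
rewrite /ht -E; apply/eqP; rewrite eqn_leq; apply/andP; split.
  by have [s [ps ls <-]] := level_path_ex v; exact: dist_le.
have [lt|] := ltnP (dist e v (rt v)) #|'I_n|.
  have [s [ps ls <-]] := dist_path lt.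
  by have := level_path ps; rewrite ls r0 add0n.
by rewrite card_ord; apply: leq_trans.
Qed.

Lemma parent_forest_of_parents v : 0 < l v -> parent forest_of_parents v = p v.
Proof.
move=> h; apply: parent_eq; first by apply/adj_parentP; left.
by rewrite !ht_forest_of_parents; exact: lp.
Qed.

End forest_of_parents.

Section forest_sum.
Variable n : nat.
Implicit Types (l : {ffun 'I_n -> 'I_n.+1}) (p : {ffun 'I_n -> 'I_n}).

(** Heights are below [n]; the larger codomain is one for which [inord] is
available for every [n]. *)
Definition levels (F : rooted_forest n) : {ffun 'I_n -> 'I_n.+1} :=
  [ffun v => inord (ht F v)].

Lemma levelsE F v : levels F v = ht F v :> nat.
Proof. by rewrite ffunE inordK// ltnW// ltnS ht_lt. Qed.

Definition parents (F : rooted_forest n) : {ffun 'I_n -> 'I_n} :=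
  [ffun v => if ht F v == 0 then v else parent F v].

Definition parent_choices l v : pred 'I_n :=
  if l v == 0 :> nat then pred1 v else [pred w | (l w).+1 == l v :> nat].

Definition compatible (lp : {ffun 'I_n -> 'I_n.+1} * {ffun 'I_n -> 'I_n}) :=
  lp.2 \in family (parent_choices lp.1).

Lemma compatibleP l p : compatible (l, p) ->
  forall v, 0 < l v -> l v = (l (p v)).+1 :> nat.
Proof.
move=> /familyP/= H v v0; have := H v; rewrite /parent_choices eqn0Ngt v0 /=.
by rewrite inE => /eqP.
Qed.

Lemma compatible_forest F : compatible (levels F, parents F).
Proof.
apply/familyP => v; rewrite /parent_choices /= levelsE ffunE.
have [_|h0] := posnP; first by rewrite inE.
have [_ ->] := parentP h0.
by rewrite inE /= levelsE.
Qed.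

Lemma levels_parents_inj F G :
  levels F = levels G -> parents F = parents G -> F = G.
Proof.
move=> El Ep.
have hE v : ht F v = ht G v by rewrite -!levelsE El.
have pE v : 0 < ht F v -> parent F v = parent G v.
  move=> h; have := congr1 (fun p : {ffun _} => p v) Ep.
  rewrite !ffunE -hE eqn0Ngt h /=; exact.
apply: val_inj; change (forest_pair F = forest_pair G).
rewrite [LHS]surjective_pairing [RHS]surjective_pairing; congr (_, _).
  change (edges F = edges G); rewrite !edgesE.
  have -> : [set v | 0 < ht F v]%SET = [set v | 0 < ht G v]%SET.
    by apply/setP => v; rewrite !inE hE.
  by apply: eq_in_imset => v; rewrite inE -hE => /pE ->.
change (roots F = roots G); rewrite !rootsE.
by apply/setP => v; rewrite !inE hE.
Qed.

Lemma compatible_ex lp : compatible lp ->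
  exists F, (levels F, parents F) = lp.
Proof.
case: lp => l p c.
have ll v : l v <= n by rewrite -ltnS.
pose F := forest_of_parents (compatibleP c).
exists F; congr (_, _); apply/ffunP => v.
  by apply: ord_inj; rewrite levelsE ht_forest_of_parents.
rewrite ffunE ht_forest_of_parents//.
move/familyP/(_ v): (c); rewrite /parent_choices /=.
have [_ /=|h0 _] := posnP; first by rewrite inE => /eqP.
by rewrite parent_forest_of_parents.
Qed.

(** Once the generation of every vertex is known, each non-root chooses its
parent freely in the previous generation. *)
Lemma sum_forests_levels (R : ringType) (Psi : {ffun 'I_n -> 'I_n.+1} -> R) :
  (\sum_(F : rooted_forest n) Psi (levels F)
   = \sum_(l : {ffun 'I_n -> 'I_n.+1})
      (\prod_(v | (0 < l v)%N) #|[set w | (l w).+1 == l v :> nat]%SET|)%:R * Psi l)%R.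
Proof.
(* On incompatible pairs the value is the edgeless forest. *)
pose dec lp := odflt (RootedForest (edgeless_subproof n))
  [pick F | (levels F, parents F) == lp].
have decK lp : compatible lp -> (levels (dec lp), parents (dec lp)) = lp.
  move=> /compatible_ex[F EF]; rewrite /dec; case: pickP => [G /eqP|] /=.
    exact.
  by move=> H; case/eqP: (negbT (H F)).
transitivity (\sum_(lp | compatible lp) Psi lp.1)%R.
  rewrite (reindex_onto (fun F => (levels F, parents F)) dec)//=.
  apply: eq_bigl => F; rewrite compatible_forest; apply/esym/eqP.
  have E := decK _ (compatible_forest F).
  exact: levels_parents_inj (congr1 fst E) (congr1 snd E).
rewrite -(pair_big_dep xpredT (fun l p => compatible (l, p)) (fun l _ => Psi l)) /=.
apply: eq_bigr => l _; rewrite sumr_const mulr_natl; congr (_ *+ _)%R.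
rewrite -[LHS]/(#|family (parent_choices l)|) card_family foldrE big_map.
rewrite big_enum [RHS]big_mkcond /=; apply: eq_bigr => v _.
rewrite /parent_choices; case: posnP => h; first exact: card1.
by apply: eq_card => w; rewrite !inE.
Qed.

End forest_sum.

Local Open Scope ring_scope.

(** * Summation over the generations *)

Section generation_sums.
Variable R : comNzRingType.

(** Sum over all ways of splitting [M] vertices into successive nonempty
generations below a generation of size [m]: there are ['C(M, z)] choices for
the next generation when it has size [z], and [m ^ z] choices of the parents.
The recursion is on the fuel [f], meant to be at least [M]. *)
Fixpoint gen_sum (f m M : nat) (Psi : seq nat -> R) : R :=
  match f, M with
  | _, 0 => Psi [:: m]
  | f'.+1, _ => \sum_(i < M) ('C(M, i.+1)%:R * m%:R ^+ i.+1
                    * gen_sum f' i.+1 (M - i.+1) (fun s => Psi (m :: s)))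
  | 0, _ => 0
  end.

Lemma sum_subsets_card (T : finType) (U : {set T}) (h : nat -> R) :
  \sum_(L : {set T} | (L \subset U) && (L != finset.set0)) h #|L|
  = \sum_(i < #|U|) 'C(#|U|, i.+1)%:R * h i.+1.
Proof.
under [RHS]eq_bigr do rewrite -cards_draws mulr_natl -sumr_const big_mkcond /=.
rewrite exchange_big [LHS]big_mkcond /=; apply: eq_bigr => L _.
have [LU|LU] /= := boolP (L \subset U); last first.
  by apply/esym/big1 => i _; rewrite inE (negbTE LU).
have [->|L0] /= := eqVneq L finset.set0.
  by apply/esym/big1 => i _; rewrite inE cards0 andbF.
have Lc : (0 < #|L|)%N by rewrite card_gt0.
have Lt : (#|L|.-1 < #|U|)%N by rewrite prednK// subset_leq_card.
rewrite (bigD1 (Ordinal Lt)) //= !inE LU /= prednK// eqxx big1 ?addr0// => i.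
rewrite inE LU /= -val_eqE /= => iL; case: eqP => // E; by rewrite E eqxx in iL.
Qed.

Variable n : nat.
Implicit Types (l : {ffun 'I_n -> 'I_n.+1}) (U L : {set 'I_n}).

(** Generations are listed up to the a priori bound [n]; the zeros that follow
the last one are removed. *)
Definition gen_sizes l : seq nat :=
  [seq x <- [seq #|[set v | l v == h :> nat]%SET| | h <- iota 0 n.+1] | x != 0%N].

(** The vertices outside [U] have the level given by [l0], those in [U] are to be
distributed over the levels from [d] on. *)
Definition extends d U l0 l :=
  [forall v, if v \in U then (d <= l v)%N else l v == l0 v].

Definition parent_weight l U : nat :=
  \prod_(v in U) #|[set w | (l w).+1 == l v :> nat]%SET|.

Lemma extendsP d U l0 l : reflect
  ((forall v, v \in U -> (d <= l v)%N) /\ (forall v, v \notin U -> l v = l0 v))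
  (extends d U l0 l).
Proof.
apply: (iffP forallP) => [H|[H1 H2] v].
  split=> v vU; have := H v; first by rewrite vU.
  by rewrite (negbTE vU) => /eqP.
by case: ifP => [/H1//|/negbT/H2 ->].
Qed.

(** A gap in the generations leaves some vertex without possible parents. *)
Lemma parent_weight_gap d U l0 l : U != finset.set0 -> 
  (forall v, v \notin U -> (l0 v <= d)%N) -> extends d.+1 U l0 l ->
  [set v in U | l v == d.+1 :> nat]%SET = finset.set0 -> parent_weight l U = 0%N.
Proof.
move=> /set0Pn[u uU] l0d /extendsP[H1 H2] L0.
(* The lowest level in U has only empty levels between it and d. *)
pose v := [arg min_(v < u in U) l v].
have [vU vmin] : v \in U /\ forall w, w \in U -> (l v <= l w)%N.
  by rewrite /v; case: arg_minnP.
rewrite /parent_weight (bigD1 v)//= (_ : #|_| = 0%N)//.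
apply/eqP; rewrite cards_eq0; apply/eqP/setP => w; rewrite !inE.
apply/negP => /eqP lw.
have [wU|wU] := boolP (w \in U).
  by have := vmin w wU; rewrite -lw ltnn.
have /setP/(_ v) := L0; rewrite !inE vU /= => /negP; apply.
rewrite eqn_leq H1// andbT -lw ltnS H2//; exact: l0d.
Qed.

Lemma gen_sumS f m M (Psi : seq nat -> R) : (0 < M)%N ->
  gen_sum f.+1 m M Psi = \sum_(i < M) ('C(M, i.+1)%:R * m%:R ^+ i.+1
                    * gen_sum f i.+1 (M - i.+1) (fun s => Psi (m :: s))).
Proof. by case: M. Qed.

Lemma gen_sum0 f m (Psi : seq nat -> R) : gen_sum f m 0 Psi = Psi [:: m].
Proof. by case: f. Qed.

(** The nonempty generations are the first [d.+1] ones, so that filtering only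
removes the empty ones after them. *)
Lemma gen_sizes_full d l : (forall v, (l v <= d)%N) ->
    (forall j, (j <= d)%N -> exists v, l v = j :> nat) ->
  gen_sizes l = [seq #|[set v | l v == j :> nat]%SET| | j <- iota 0 d.+1].
Proof.
move=> ld lex; have [v0 v0d] := lex d (leqnn d).
have dn : (d <= n)%N by rewrite -v0d -ltnS.
rewrite /gen_sizes (_ : iota 0 n.+1 = iota 0 d.+1 ++ iota d.+1 (n - d)); last first.
  by rewrite -iotaD addSn subnKC.
rewrite map_cat filter_cat.
rewrite [X in _ ++ X](_ : _ = [::]) ?cats0.
  apply/all_filterP/allP => x /mapP[j]; rewrite -/(iota 0 d.+1) mem_iota add0n ltnS.
  move=> jd ->; have [v lv] := lex j jd; apply/negP; rewrite cards_eq0 => /eqP/setP/(_ v).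
  by rewrite !inE lv eqxx.
apply/eqP; rewrite -[_ == _]negbK -has_filter; apply/hasPn => x /mapP[j].
rewrite mem_iota => /andP[dj _] ->; rewrite negbK cards_eq0; apply/eqP/setP => v.
by rewrite !inE; apply/negP => /eqP lv; have := ld v; rewrite lv leqNgt dj.
Qed.

Lemma iotaS_rcons d : iota 0 d.+1 = rcons (iota 0 d) d.
Proof. by rewrite -addn1 iotaD cats1. Qed.

Lemma sum_levels0 f d U l0 (Psi : seq nat -> R) : U = finset.set0 ->
    (forall v, v \notin U -> (l0 v <= d)%N) ->
    (forall j, (j <= d)%N -> exists2 v, v \notin U & l0 v = j :> nat) ->
  \sum_(l | extends d.+1 U l0 l) (parent_weight l U)%:R * Psi (gen_sizes l)
  = gen_sum f #|[set v | (v \notin U) && (l0 v == d :> nat)]%SET| #|U|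
     (fun s => Psi ([seq #|[set v | (v \notin U) && (l0 v == j :> nat)]%SET|
                     | j <- iota 0 d] ++ s)).
Proof.
move=> -> l0d l0ex; rewrite cards0 gen_sum0 (big_pred1 l0) => [|l]; last first.
  apply/extendsP/eqP => [[_ H]|->]; last by split => // v; rewrite inE.
  by apply/ffunP => v; apply: H; rewrite inE.
rewrite /parent_weight big_set0 mul1r (@gen_sizes_full d).
- rewrite cats1 iotaS_rcons map_rcons; congr (Psi (rcons _ _)).
    by apply: eq_map => j; apply: eq_card => v; rewrite !inE.
  by apply: eq_card => v; rewrite !inE.
- by move=> v; apply: l0d; rewrite inE.
- by move=> j /l0ex[v]; exists v.
Qed.

(** The generations from [d.+1] on are summed over by choosing which vertices
of [U] form generation [d.+1], all of them having the same number of possible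
parents. *)
Lemma sum_levels f d U l0 (Psi : seq nat -> R) :
    (#|U| <= f)%N -> (d + #|U| < n)%N ->
    (forall v, v \notin U -> (l0 v <= d)%N) ->
    (forall j, (j <= d)%N -> exists2 v, v \notin U & l0 v = j :> nat) ->
  \sum_(l | extends d.+1 U l0 l) (parent_weight l U)%:R * Psi (gen_sizes l)
  = gen_sum f #|[set v | (v \notin U) && (l0 v == d :> nat)]%SET| #|U|
     (fun s => Psi ([seq #|[set v | (v \notin U) && (l0 v == j :> nat)]%SET|
                     | j <- iota 0 d] ++ s)).
Proof.
elim: f d U l0 Psi => [|f IH] d U l0 Psi Uf dUn l0d l0ex.
  by apply: sum_levels0 => //; apply/eqP; rewrite -cards_eq0 -leqn0.
have [U0|U0] := eqVneq U finset.set0; first exact: sum_levels0.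
rewrite gen_sumS ?card_gt0//.
set m := #|[set v | (v \notin U) && (l0 v == d :> nat)]%SET|; set acc := [seq _ | _ <- _].
transitivity (\sum_(L : {set 'I_n} | (L \subset U) && (L != finset.set0))
    (m%:R ^+ #|L| * gen_sum f #|L| (#|U| - #|L|) (fun s => Psi (acc ++ m :: s)))); last first.
  rewrite (sum_subsets_card U (fun z => m%:R ^+ z * gen_sum f z (#|U| - z)
    (fun s => Psi (acc ++ m :: s)))).
  by apply: eq_bigr => i _; rewrite mulrA.
(* L is generation d.+1; an empty one contributes nothing. *)
pose lev l := [set v in U | l v == d.+1 :> nat]%SET.
rewrite (partition_big lev (fun L => L \subset U)) /=; last first.
  by move=> l _; apply/fintype.subsetP => v; rewrite inE => /andP[].
rewrite (bigID (fun L : {set 'I_n} => L != finset.set0)) /= addrC big1 ?add0r; last first.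
  move=> L /andP[_]; rewrite negbK => /eqP ->; apply: big1 => l /andP[e /eqP E].
  by rewrite (parent_weight_gap U0 l0d e E) mul0r.
apply: eq_bigr => L /andP[LU L0].
have L1 : (0 < #|L|)%N by rewrite card_gt0.
have LcU := subset_leq_card LU.
have dn : (d.+1 < n.+1)%N.
  by rewrite ltnS; apply: leq_trans dUn; rewrite ltnS leq_addr.
pose l1 : {ffun 'I_n -> 'I_n.+1} := [ffun v => if v \in L then inord d.+1 else l0 v].
have l1L v : v \in L -> l1 v = d.+1 :> nat by move=> vL; rewrite ffunE vL inordK.
have l1N v : v \notin L -> l1 v = l0 v by move=> vL; rewrite ffunE (negbTE vL).
have notD v : (v \notin U :\: L)%SET = (v \in L) || (v \notin U).
  by rewrite inE negb_and negbK.
have cD : #|U :\: L|%SET = (#|U| - #|L|)%N.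
  by rewrite cardsD (finset.setIidPr LU).
have UL w : w \notin U -> w \notin L by apply: contra; exact: fintype.subsetP.
have := IH d.+1 (U :\: L)%SET l1 Psi.
have -> : [set v | (v \notin U :\: L)%SET && (l1 v == d.+1 :> nat)]%SET = L.
  apply/setP => v; rewrite inE notD; have [vL|vL] /= := boolP (v \in L).
    by rewrite l1L// eqxx.
  rewrite l1N//; apply/andP => -[/l0d + /eqP E]; by rewrite E ltnn.
rewrite cD.
have -> : [seq #|[set v | (v \notin U :\: L)%SET && (l1 v == j :> nat)]%SET| | j <- iota 0 d.+1]
    = rcons acc m.
  rewrite iotaS_rcons map_rcons.
  have aux j : (j <= d)%N -> #|[set v | (v \notin U :\: L)%SET && (l1 v == j :> nat)]%SET|
      = #|[set v | (v \notin U) && (l0 v == j :> nat)]%SET|.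
    move=> jd; apply: eq_card => v; rewrite !inE negb_and negbK.
    have [vL|vL] /= := boolP (v \in L); last by rewrite l1N.
    rewrite (fintype.subsetP LU)//= l1L//; apply/eqP => E; by rewrite -E ltnn in jd.
  congr rcons; last exact: aux.
  by apply/eq_in_map => j; rewrite mem_iota add0n => /andP[_ /ltnW/aux].
have -> : (fun s => Psi (rcons acc m ++ s)) = (fun s => Psi (acc ++ m :: s)).
  by apply/funext => s; rewrite cat_rcons.
move=> <-; first last.
- move=> j; rewrite leq_eqVlt => /orP[/eqP ->|jd].
    by move/set0Pn: L0 => [v vL]; exists v; rewrite ?notD ?vL// l1L.
  have [v vU vj] := l0ex j jd; exists v; first by rewrite notD vU orbT.
  by rewrite l1N// UL.
- move=> v; rewrite notD; have [vL _|vL /= vU] := boolP (v \in L).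
    by rewrite l1L.
  by rewrite l1N// leqW// l0d.
- by apply: leq_ltn_trans dUn; rewrite addSn -addnS leq_add2l ltn_subrL L1 card_gt0.
- by rewrite leq_subLR; apply: leq_trans Uf _; rewrite -add1n leq_add2r.
rewrite big_distrr /=; apply: eq_big => [l|l /andP[el /eqP levl]].
  apply/andP/extendsP => [[/extendsP[H1 H2] /eqP E]|[H1 H2]].
    split=> v; rewrite ?notD => vU; last first.
      case/orP: vU => [vL|vU]; last by rewrite H2// l1N// UL.
      by apply: ord_inj; rewrite l1L//; move: vL; rewrite -E inE => /andP[_ /eqP].
    move: vU; rewrite inE => /andP[vL vU]; rewrite ltn_neqAle H1// andbT.
    by apply: contra vL => /eqP Ev; rewrite -E inE vU -Ev eqxx.
  have lL v : v \in L -> l v = d.+1 :> nat.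
    by move=> vL; rewrite H2 ?notD ?vL// l1L.
  split.
    apply/extendsP; split=> v vU; last by rewrite H2 ?notD ?vU ?orbT// l1N// UL.
    have [vL|vL] := boolP (v \in L); first by rewrite lL.
    by apply/ltnW/H1; rewrite inE vL.
  apply/eqP/setP => v; rewrite inE; have [vL|vL] := boolP (v \in L).
    by rewrite (fintype.subsetP LU)// lL// eqxx.
  apply/andP => -[vU /eqP E]; have := H1 v; rewrite inE vL vU E ltnn => /(_ isT)//.
rewrite mulrA; congr (_ * _); rewrite -natrX -natrM; congr (_%:R).
rewrite /parent_weight (big_setID L) /= (finset.setIidPr LU); congr (_ * _)%N.
rewrite -prod_nat_const; apply: eq_bigr => v vL.
have lv : l v = d.+1 :> nat.
  by move: vL; rewrite -levl inE => /andP[_ /eqP].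
have /extendsP[H1 H2] := el.
apply: eq_card => w; rewrite !inE lv eqSS; have [wU|wU] /= := boolP (w \in U).
  by apply/eqP => E; have := H1 w wU; rewrite E ltnn.
by rewrite H2.
Qed.

End generation_sums.

(** * The profile of a forest *)

Section profile.
Variable n : nat.
Implicit Types F : rooted_forest n.

Definition profile F := gen_sizes (levels F).

Lemma sum_forests_profile (R : comNzRingType) k (Psi : seq nat -> R) :
  (1 <= k <= n)%N ->
  \sum_(F : rooted_forest n | #|roots F| == k) Psi (profile F)
  = 'C(n, k)%:R * gen_sum (n - k) k (n - k) Psi.
Proof.
move=> /andP[k1 kn].
pose lev0 (l : {ffun 'I_n -> 'I_n.+1}) := [set v | l v == 0 :> nat]%SET.
pose Phi l : R := if #|lev0 l| == k then Psi (gen_sizes l) else 0.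
transitivity (\sum_(F : rooted_forest n) Phi (levels F)).
  rewrite big_mkcond; apply: eq_bigr => F _; rewrite /Phi rootsE.
  rewrite (_ : lev0 _ = [set v | ht F v == 0]%SET)//.
  by apply/setP => v; rewrite !inE levelsE.
rewrite sum_forests_levels (partition_big lev0 xpredT)//=.
rewrite (bigID (fun L : {set 'I_n} => #|L| == k)) /= addrC big1 ?add0r; last first.
  move=> L Lk; apply: big1 => l /eqP E.
  by rewrite /Phi E (negbTE Lk) mulr0.
rewrite (eq_bigr (fun _ => gen_sum (n - k) k (n - k) Psi)) => [|L /eqP Lk].
  rewrite sumr_const mulr_natl; congr (_ *+ _).
  by rewrite -[in RHS](card_ord n) -card_draws; apply: eq_card => L; rewrite inE.
have cLC : #|~: L|%SET = (n - k)%N by rewrite cardsCs finset.setCK card_ord Lk.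
pose l0 : {ffun 'I_n -> 'I_n.+1} := [ffun => ord0].
have := @sum_levels R n (n - k) 0 (~: L)%SET l0 Psi.
rewrite cLC (_ : #|_| = k) => [|]; last first.
  by rewrite -Lk; apply: eq_card => v; rewrite !inE ffunE negbK andbT.
move=> <-//.
- apply: eq_big => [l|l /eqP El].
    apply/eqP/extendsP => [El|[H1 H2]].
      split=> v; rewrite ?inE ?negbK -El inE.
        by rewrite lt0n.
      by move=> /eqP l0v; apply: ord_inj; rewrite ffunE.
    apply/setP => v; rewrite inE; have [vL|vL] := boolP (v \in L).
      by rewrite H2 ?ffunE// inE negbK.
    by apply/negbTE; rewrite -lt0n; apply: H1; rewrite inE.
  rewrite /Phi El Lk eqxx /parent_weight; congr (_ * _); congr (_%:R).
  by apply: eq_bigl => v; rewrite inE -El inE lt0n.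
- by rewrite add0n ltn_subrL k1 (leq_trans k1 kn).
- by move=> v _; rewrite ffunE.
- move=> j; rewrite leqn0 => /eqP ->.
  have /card_gt0P[v vL] : (0 < #|L|)%N by rewrite Lk.
  by exists v; rewrite ?inE ?negbK// ffunE.
Qed.

(** The heights along the line of descent of [v] take all the values below
[ht F v]. *)
Lemma ht_contiguous F v j : (j <= ht F v)%N -> exists w, ht F w = j.
Proof.
move E : (ht F v) => h; elim: h v E => [|h IH] v E.
  by rewrite leqn0 => /eqP ->; exists v.
rewrite leq_eqVlt => /orP[/eqP ->|]; first by exists v.
have [|_ hp] := @parentP n F v; first by rewrite E.
by apply: (IH (parent F v)); apply/eqP; rewrite -eqSS -hp E.
Qed.

Fixpoint height_sum (s : seq nat) : nat :=
  if s is m :: s' then sumn s' + height_sum s' else 0.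

Lemma height_sumE (c : nat -> nat) a m :
  height_sum [seq c j | j <- iota a m] = (\sum_(a <= j < a + m) (j - a) * c j)%N.
Proof.
elim: m a => [|m IH] a /=; first by rewrite addn0 big_geq.
rewrite big_ltn ?addnS ?ltnS ?leq_addr// subnn mul0n add0n IH.
rewrite sumnE big_map -/(index_iota _ _) addSn.
rewrite (_ : iota a.+1 m = index_iota a.+1 (a + m).+1); last first.
  by rewrite /index_iota subSS addKn.
rewrite -big_split /= big_nat_cond [RHS]big_nat_cond; apply: eq_bigr => j.
by rewrite andbT => /andP[aj _]; rewrite -mulSn subnSK.
Qed.

Lemma sum_by_level F (g : nat -> nat) :
  (\sum_v g (ht F v) = \sum_(0 <= j < n.+1) g j * #|[set v | levels F v == j :> nat]%SET|)%N.
Proof.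
rewrite big_mkord (partition_big (levels F) xpredT)//=.
apply: eq_bigr => j _; rewrite mulnC -sum_nat_const.
apply: eq_big => [v|v /eqP <-]; first by rewrite inE -val_eqE.
by rewrite levelsE.
Qed.

Lemma sum_ht F : (\sum_v ht F v = height_sum (profile F))%N.
Proof.
rewrite (sum_by_level F id).
have [v1 _|none] := pickP (fun _ : 'I_n => true); last first.
  have c0 h : #|[set v | levels F v == h :> nat]%SET| = 0%N.
    by apply: eq_card0 => v; have := none v.
  rewrite big1 => [|j _]; last by rewrite c0 muln0.
  rewrite /profile /gen_sizes (eq_map c0).
  by elim: (iota _ _).
have [v0 /= v0max] : exists v0, forall v, (ht F v <= ht F v0)%N.
  by exists [arg max_(v > v1) ht F v]; case: arg_maxnP => // v _ H w; exact: H.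
have dn := ht_lt F v0; set d := ht F v0 in v0max dn.
have -> : profile F = [seq #|[set v | levels F v == j :> nat]%SET| | j <- iota 0 d.+1].
  apply: gen_sizes_full => [v|j jd]; first by rewrite levelsE.
  by have [w hw] := ht_contiguous jd; exists w; rewrite levelsE.
rewrite height_sumE add0n (big_cat_nat _ (n := d.+1))//=; last exact: leqW.
rewrite [X in (_ + X)%N]big_nat_cond [X in (_ + X)%N]big1 ?addn0.
  by apply: eq_bigr => j _; rewrite subn0.
move=> j; rewrite andbT => /andP[dj _]; rewrite (_ : #|_| = 0%N) ?muln0//.
apply/eqP; rewrite cards_eq0; apply/eqP/setP => v; rewrite !inE levelsE.
by apply/negP => /eqP E; have := v0max v; rewrite E leqNgt dj.
Qed.

(** All vertices of a generation of size [m] have [m - 1] cousins. *)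
Lemma sum_csn F : (\sum_v csn F v = \sum_(m <- profile F) m * m.-1)%N.
Proof.
have csnE v : csn F v = #|[set w | levels F w == ht F v :> nat]%SET|.-1.
  rewrite (cardsD1 v [set w | _]%SET) inE levelsE eqxx /=.
  by apply: eq_card => w; rewrite !inE levelsE andbC.
under eq_bigr do rewrite csnE.
rewrite (sum_by_level F (fun j => #|[set w | levels F w == j :> nat]%SET|.-1)).
rewrite /profile /gen_sizes big_filter big_map [RHS]big_mkcond /index_iota subn0.
apply: eq_bigr => j _; rewrite mulnC.
by case: eqP => // ->.
Qed.

End profile.

(** * Means for the binomial law *)

Section binomial_mean.
Variable R : realFieldType.
Implicit Types (p : R) (g : nat -> R).

Definition binE N p g : R :=
  \sum_(i < N.+1) 'C(N, i)%:R * p ^+ i * (1 - p) ^+ (N - i) * g i.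

Lemma binE0 p g : binE 0 p g = g 0%N.
Proof. by rewrite /binE big_ord1 bin0 !expr0 !mul1r. Qed.

(** Condition on the outcome of the last trial. *)
Lemma binES N p g :
  binE N.+1 p g = (1 - p) * binE N p g + p * binE N p (fun i => g i.+1).
Proof.
rewrite /binE big_ord_recl /= bin0 expr0 subn0 /bump /=.
under eq_bigr => i _ do
  rewrite add1n binS natrD subSS !mulrDl.
rewrite big_split /= addrA; congr (_ + _); last first.
  by rewrite mulr_sumr; apply: eq_bigr => i _; rewrite exprS; ring.
rewrite big_ord_recr /= bin_small// !mul0r addr0 mulr_sumr big_ord_recl /= bin0 subn0 expr0.
congr (_ + _); first by rewrite exprS; ring.
apply: eq_bigr => i _; rewrite /bump /= add1n.
have -> : (N - i = (N - i.+1).+1)%N by rewrite subnSK.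
by rewrite !exprS; ring.
Qed.

Lemma binED N p g h : binE N p (fun i => g i + h i) = binE N p g + binE N p h.
Proof. by rewrite -big_split; apply: eq_bigr => i _; rewrite /= mulrDr. Qed.

Lemma binEZ N p c g : binE N p (fun i => c * g i) = c * binE N p g.
Proof. by rewrite mulr_sumr; apply: eq_bigr => i _; rewrite mulrCA. Qed.

Lemma binE_cst N p c : binE N p (fun _ => c) = c.
Proof.
elim: N c => [|N IH] c; first by rewrite binE0.
by rewrite binES IH -mulrDl subrK mul1r.
Qed.

Lemma binE_le N p g h : 0 <= p <= 1 ->
  (forall i, (i <= N)%N -> g i <= h i) -> binE N p g <= binE N p h.
Proof.
move=> /andP[p0 p1] gh; apply: ler_sum => i _; apply: ler_wpM2l.
  by rewrite !mulr_ge0 ?exprn_ge0// subr_ge0.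
by apply: gh; rewrite -ltnS.
Qed.

Lemma eq_binE N p g h : (forall i, (i <= N)%N -> g i = h i) ->
  binE N p g = binE N p h.
Proof. by move=> gh; apply: eq_bigr => i _; rewrite gh// -ltnS. Qed.

Lemma binE_norm N p g : 0 <= p <= 1 -> `|binE N p g| <= binE N p (fun i => `|g i|).
Proof.
move=> p01; rewrite ler_norml -[X in X <= _]mulN1r -binEZ.
by rewrite !binE_le// => i _; rewrite ?mulN1r ?ler_norm// lerNl ler_normr lexx orbT.
Qed.

(** By induction on [N]: the last trial shifts the centred variable by [- p] or by
[1 - p], and the binomial theorem reduces to the moments for [N]. *)
Lemma binE_central N p : let q := 1 - p in
  [/\ binE N p (fun i => i%:R - N%:R * p) = 0,
   binE N p (fun i => (i%:R - N%:R * p) ^+ 2) = N%:R * p * q,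
   binE N p (fun i => (i%:R - N%:R * p) ^+ 3) = N%:R * p * q * (q - p) &
   binE N p (fun i => (i%:R - N%:R * p) ^+ 4)
     = 3 * (N%:R * p * q) ^+ 2 + N%:R * p * q * (1 - 6 * (p * q))].
Proof.
move=> q; rewrite /q {q}; elim: N => [|N [IH1 IH2 IH3 IH4]].
  by rewrite !binE0; split; ring.
have step k : binE N.+1 p (fun i => (i%:R - N.+1%:R * p) ^+ k) =
    (1 - p) * binE N p (fun i => ((i%:R - N%:R * p) - p) ^+ k)
    + p * binE N p (fun i => ((i%:R - N%:R * p) + (1 - p)) ^+ k).
  rewrite binES; congr (_ * _ + _ * _); apply: eq_binE => i _; congr (_ ^+ _);
    rewrite -?natr1; ring.
have exp a k : binE N p (fun i => ((i%:R - N%:R * p) + a) ^+ k)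
   = \sum_(j < k.+1) 'C(k, j)%:R * a ^+ j * binE N p (fun i => (i%:R - N%:R * p) ^+ (k - j)).
  transitivity (binE N p (fun i => \sum_(j < k.+1) ('C(k, j)%:R * a ^+ j) * (i%:R - N%:R * p) ^+ (k - j))).
    apply: eq_binE => i _; rewrite exprDn; apply: eq_bigr => j _.
    by rewrite -mulr_natl; ring.
  rewrite /binE; under eq_bigr do rewrite mulr_sumr.
  rewrite exchange_big /=; apply: eq_bigr => j _; rewrite mulr_sumr; apply: eq_bigr => i _.
  ring.
have e0 : binE N p (fun i => (i%:R - N%:R * p) ^+ 0) = 1.
  by under eq_binE do rewrite expr0; rewrite binE_cst.
have e1 : binE N p (fun i => (i%:R - N%:R * p) ^+ 1) = 0.
  by under eq_binE do rewrite expr1.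
have expN k := exp (- p) k; have expP k := exp (1 - p) k.
have bins := (bin0, bin1, binn, (erefl : 'C(3, 2) = 3%N), (erefl : 'C(4, 2) = 6%N),
  (erefl : 'C(4, 3) = 4%N)).
split.
- have := step 1; under eq_binE do rewrite expr1.
  move=> ->; rewrite expN expP !big_ord_recr !big_ord0 /=.
  rewrite ?(e0, e1) !bins; ring.
- rewrite step expN expP !big_ord_recr !big_ord0 /=.
  rewrite ?(e0, e1, IH2) !bins -natr1; ring.
- rewrite step expN expP !big_ord_recr !big_ord0 /=.
  rewrite ?(e0, e1, IH2, IH3) !bins -natr1; ring.
- rewrite step expN expP !big_ord_recr !big_ord0 /=.
  rewrite ?(e0, e1, IH2, IH3, IH4) !bins -natr1; ring.
Qed.

End binomial_mean.

(** * The chain of generation sizes *)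

Section generation_chain.
Variable R : realFieldType.
Implicit Types (Psi Phi : seq nat -> R).

(** Success probability of the binomial law that gives the next generation. *)
Definition link_prob (m M : nat) : R := m%:R / (m + M)%:R.

(** Mean of [Psi] over the paths of the chain that starts from [m] vertices with [M]
vertices below them: the next generation has size [i.+1] with [i] binomial. The
recursion is on the fuel [f], meant to be at least [M]. *)
Fixpoint chainE (f m M : nat) Psi : R :=
  match f, M with
  | _, 0 => Psi [:: m]
  | f'.+1, M'.+1 => binE M' (link_prob m M)
        (fun i => chainE f' i.+1 (M' - i) (fun s => Psi (m :: s)))
  | 0, _ => 0
  end.

Lemma chainE0 f m Psi : chainE f m 0 Psi = Psi [:: m].
Proof. by case: f. Qed.

Lemma chainES f m M Psi : chainE f.+1 m M.+1 Psi =
  binE M (link_prob m M.+1)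
    (fun i => chainE f i.+1 (M - i) (fun s => Psi (m :: s))).
Proof. by []. Qed.

Lemma link_prob01 m M : 0 <= link_prob m M <= 1.
Proof.
rewrite /link_prob; case: m => [|m]; first by rewrite mul0r lexx ler01.
by rewrite divr_ge0 ?ler0n//= ler_pdivrMr ?ltr0n// mul1r ler_nat leq_addr.
Qed.

(** Cayley's count of forests, [m (m + M)^(M - 1)], is the total mass that
turns the sum over generations into the mean for a Markov chain. *)
Lemma gen_sum_chainE f m M Psi : (M <= f)%N -> (0 < m)%N ->
  gen_sum f m M Psi * (m + M)%:R = m%:R * (m + M)%:R ^+ M * chainE f m M Psi.
Proof.
elim: f m M Psi => [|f IH] m [|M] Psi // Mf m0; rewrite ?gen_sum0 ?chainE0.
- by rewrite addn0 expr0 mulr1 mulrC.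
- by rewrite addn0 expr0 mulr1 mulrC.
rewrite gen_sumS// /chainE -/chainE mulr_suml mulr_sumr; apply: eq_bigr => i _.
have iM : (i <= M)%N by rewrite -ltnS.
have := IH i.+1 (M - i)%N (fun s => Psi (m :: s)).
rewrite (leq_trans (leq_subr _ _))// => /(_ isT isT).
have -> : (i.+1 + (M - i) = M.+1)%N by rewrite addSn subnKC.
rewrite subSS; set G := gen_sum _ _ _ _; set C := chainE _ _ _ _ => E.
have N0 : (m + M.+1)%:R != 0 :> R by rewrite pnatr_eq0 addnS.
have M0 : M.+1%:R != 0 :> R by rewrite pnatr_eq0.
have binE' : 'C(M.+1, i.+1)%:R * i.+1%:R = M.+1%:R * 'C(M, i)%:R :> R.
  by rewrite -!natrM mul_bin_diag mulnC.
have qE : 1 - link_prob m M.+1 = M.+1%:R / (m + M.+1)%:R.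
  rewrite /link_prob; apply: (mulIf N0); rewrite mulrBl !divfK// mul1r natrD; ring.
have GE : G = i.+1%:R * M.+1%:R ^+ (M - i) / M.+1%:R * C.
  by apply: (mulIf M0); rewrite E; field.
rewrite qE /link_prob GE.
have -> : 'C(M.+1, i.+1)%:R = M.+1%:R * 'C(M, i)%:R / i.+1%:R :> R.
  by rewrite -binE' mulfK// pnatr_eq0.
have -> : (m + M.+1)%:R ^+ M.+1 = (m + M.+1)%:R ^+ (i + (M - i)).+1 :> R by rewrite subnKC.
rewrite !exprMn !exprVn !exprS exprD.
set k := (M - i)%N.
have ? : i.+1%:R != 0 :> R by rewrite pnatr_eq0.
field.
by rewrite !expf_neq0 // !nat1r !pnatr_eq0.
Qed.

(** Paths on which the chain is supported. *)
Definition chain_path (m M : nat) (s : seq nat) :=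
  [&& head 0%N s == m, sumn s == (m + M)%N & all (fun z => 0 < z)%N s].

Lemma chain_path_cons m M z s : (0 < m)%N -> (z <= M)%N ->
  chain_path z (M - z) s -> chain_path m M (m :: s).
Proof.
move=> m0 zM /and3P[_ /eqP ss ps]; rewrite /chain_path /= eqxx m0 ps ss.
by rewrite subnKC// eqxx.
Qed.

Lemma chain_path1 m : (0 < m)%N -> chain_path m 0 [:: m].
Proof. by move=> m0; rewrite /chain_path /= m0 !eqxx. Qed.

Lemma eq_chainE f m M Psi Phi : (M <= f)%N -> (0 < m)%N ->
    (forall s, chain_path m M s -> Psi s = Phi s) ->
  chainE f m M Psi = chainE f m M Phi.
Proof.
elim: f m M Psi Phi => [|f IH] m [|M] Psi Phi // Mf m0 H;
  rewrite ?chainE0; try exact/H/chain_path1.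
apply: eq_binE => i iM; apply: IH => //; first by apply: leq_trans (leq_subr _ _) _.
move=> s ps; apply: H; apply: (@chain_path_cons _ _ i.+1) => //.
Qed.

Lemma chainE_le f m M Psi Phi : (M <= f)%N -> (0 < m)%N ->
    (forall s, chain_path m M s -> Psi s <= Phi s) ->
  chainE f m M Psi <= chainE f m M Phi.
Proof.
elim: f m M Psi Phi => [|f IH] m [|M] Psi Phi // Mf m0 H;
  rewrite ?chainE0; try exact/H/chain_path1.
apply: binE_le => [|i iM]; first exact: link_prob01.
apply: IH => //; first by apply: leq_trans (leq_subr _ _) _.
move=> s ps; apply: H; apply: (@chain_path_cons _ _ i.+1) => //.
Qed.

Lemma chainED f m M Psi Phi :
  chainE f m M (fun s => Psi s + Phi s) = chainE f m M Psi + chainE f m M Phi.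
Proof.
elim: f m M Psi Phi => [|f IH] m [|M] Psi Phi //=; first by rewrite addr0.
by rewrite -binED; apply: eq_binE => i _; rewrite IH.
Qed.

Lemma chainEZ f m M c Psi :
  chainE f m M (fun s => c * Psi s) = c * chainE f m M Psi.
Proof.
elim: f m M Psi => [|f IH] m [|M] Psi //=; first by rewrite mulr0.
by rewrite -binEZ; apply: eq_binE => i _; rewrite IH.
Qed.

Lemma chainE_cst f m M c : (M <= f)%N -> chainE f m M (fun _ => c) = c.
Proof.
elim: f m M => [|f IH] m [|M] //= Mf.
rewrite -[RHS](binE_cst M (link_prob m M.+1)); apply: eq_binE => i _; apply: IH.
by apply: leq_trans (leq_subr _ _) _.
Qed.

Lemma chainE_norm f m M Psi : (M <= f)%N -> (0 < m)%N ->
  `|chainE f m M Psi| <= chainE f m M (fun s => `|Psi s|).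
Proof.
move=> Mf m0; rewrite ler_norml -[X in X <= _]mulN1r -chainEZ.
by rewrite !chainE_le// => s _; rewrite ?mulN1r ?ler_norm// lerNl ler_normr lexx orbT.
Qed.

(** [g m M z] is paid when [m] vertices with [M] vertices below them have [z]
children, and [h m] for the last generation. *)
Fixpoint cost (g : nat -> nat -> nat -> R) (h : nat -> R) (s : seq nat) : R :=
  if s is m :: s' then
    if s' is z :: _ then g m (sumn s') z + cost g h s' else h m
  else 0.

Lemma cost_cons g h m M z s : (0 < z)%N -> (z <= M)%N ->
  chain_path z (M - z) s -> cost g h (m :: s) = g m M z + cost g h s.
Proof.
move=> z0 zM; case: s => [|z' s] /and3P[/eqP /= hz /eqP ss _].
  by rewrite -hz in z0.
by rewrite /= hz -(subnKC zM) -ss /= hz.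
Qed.

(** The supermartingale bound: a potential that pays for one step and for the
potential after it pays for the whole path. *)
Lemma chainE_cost_le g h (Phi : nat -> nat -> R) :
    (forall m, h m <= Phi m 0%N) ->
    (forall m M, (0 < m)%N ->
      binE M (link_prob m M.+1) (fun i => g m M.+1 i.+1 + Phi i.+1 (M - i)%N)
      <= Phi m M.+1) ->
  forall f m M, (M <= f)%N -> (0 < m)%N -> chainE f m M (cost g h) <= Phi m M.
Proof.
move=> H0 H1; elim=> [|f IH] m [|M] // Mf m0; rewrite ?chainE0; try exact: H0.
rewrite chainES; apply: le_trans (H1 m M m0); apply: binE_le => [|i iM]; first exact: link_prob01.
have Mif : (M - i <= f)%N by apply: leq_trans (leq_subr _ _) _.
rewrite (_ : chainE _ _ _ _ = g m M.+1 i.+1 + chainE f i.+1 (M - i) (cost g h)); last first.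
  rewrite -[g m _ _](chainE_cst i.+1 _ Mif) -chainED.
  by apply: eq_chainE => // s ps; rewrite (@cost_cons _ _ _ M.+1 i.+1).
by rewrite lerD2l; apply: IH.
Qed.

End generation_chain.

(** * Functionals of a path of the chain *)

Section chain_costs.
Variable R : realFieldType.
Implicit Types (s : seq nat).

Definition square_sum s : R := \sum_(m <- s) m%:R ^+ 2.
(** The increment is [(m + M) * xi], where [xi] is [z] minus its conditional mean
[1 + (M - 1) * m / (m + M)]. *)
Definition martingale : seq nat -> R :=
  cost (fun m M z => (m + M)%:R * (z%:R - 1) - (M%:R - 1) * m%:R) (fun _ => 0).
(** The increment is the conditional variance of that of [martingale], see
[variation_step]. *)
Definition variation : seq nat -> R :=
  cost (fun m M z => M%:R * (M%:R - 1) * m%:R) (fun _ => 0).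
Definition jump_sum : seq nat -> R :=
  cost (fun m M z => (z%:R - m%:R) ^+ 2) (fun _ => 0).
Definition last_square : seq nat -> R := cost (fun _ _ _ => 0) (fun m => m%:R ^+ 2).
Definition cube_sum : seq nat -> R :=
  cost (fun m M z => m%:R ^+ 3 / (m + M)%:R) (fun m => m%:R ^+ 2).

Lemma costE g h m z s :
  cost g h (m :: z :: s) = g m (sumn (z :: s)) z + cost g h (z :: s) :> R.
Proof. by []. Qed.

(** Summation by parts: the increment of [martingale] is that of the product of
the size of a generation and the number of vertices below it, plus
[z ^ 2 + m * z - M], and [2 * m * z = m ^ 2 + z ^ 2 - (z - m) ^ 2]. *)
Lemma height_square_sum m s :
  (height_sum (m :: s))%:R / 2 - square_sum (m :: s)
  = - (m%:R * (sumn s)%:R) / 2 - martingale (m :: s) / 2 - 3 / 4 * m%:R ^+ 2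
    - last_square (m :: s) / 4 - jump_sum (m :: s) / 4 :> R.
Proof.
rewrite /martingale /last_square /jump_sum /square_sum.
elim: s m => [|z s IH] m.
  by rewrite /= addn0 big_cons big_nil; field.
rewrite big_cons.
have -> : height_sum (m :: z :: s) = (sumn (z :: s) + height_sum (z :: s))%N by [].
rewrite !costE natrD [sumn (z :: s)]/= natrD.
have -> : (height_sum (z :: s))%:R = 2 * (\sum_(j <- z :: s) j%:R ^+ 2
    + ((height_sum (z :: s))%:R / 2 - \sum_(j <- z :: s) j%:R ^+ 2)) :> R by field.
by rewrite IH natrD; field.
Qed.

Lemma variation_ge0 s : 0 <= variation s.
Proof.
rewrite /variation; elim: s => [|m [|z s] IH] //=; rewrite addr_ge0//.
case: (z + sumn s)%N => [|M]; first by rewrite !mul0r.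
by rewrite -natr1 addrK !mulr_ge0// addr_ge0.
Qed.

Lemma square_sum_cons m s : square_sum (m :: s) = m%:R ^+ 2 + square_sum s.
Proof. by rewrite /square_sum big_cons. Qed.

Lemma square_sum_ge0 s : 0 <= square_sum s.
Proof. by apply: sumr_ge0 => m _; rewrite exprn_ge0. Qed.

(** Up to lower order terms [3 * M ^ 2 * m] is [(m + M) ^ 3 - M ^ 3], whose sum
telescopes. *)
Lemma variation_bounds s :
  3 * variation s <= (sumn s)%:R ^+ 3 <= 3 * variation s + 7 * (sumn s)%:R * square_sum s.
Proof.
rewrite /variation; elim: s => [|m [|z s] IH].
- by rewrite /square_sum big_nil /= expr0n /=; apply/andP; split; lra.
- rewrite /= mulr0 addn0 exprn_ge0//= add0r /square_sum big_seq1.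
  rewrite -[_ ^+ 3]mul1r exprS mulrA ler_wpM2r ?exprn_ge0//.
  by rewrite ler_wpM2r// ler1n.
rewrite costE square_sum_cons -[sumn (m :: _)]/(m + sumn (z :: s))%N natrD.
move: IH; set V := cost _ _ _; set Q := square_sum _; set M := sumn (z :: s).
have Q0 : 0 <= Q by exact: square_sum_ge0.
have : 0 <= m%:R :> R by [].
have : m%:R <= m%:R ^+ 2 :> R by rewrite -natrX ler_nat; case: (m) => // k; rewrite leq_pmulr.
have : 0 <= M%:R :> R by [].
move: (M%:R : R) (m%:R : R) => {}M {}m M0 m2 m0 /andP[H1 H2]; apply/andP; split.
  have : 0 <= M * m by exact: mulr_ge0.
  have : 0 <= M * m ^+ 2 by rewrite mulr_ge0// exprn_ge0.
  have : 0 <= m ^+ 3 by exact: exprn_ge0.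
  nra.
have h1 : M * m <= M * m ^+ 2 by rewrite ler_wpM2l.
have h2 : 0 <= m * Q by exact: mulr_ge0.
have h3 : 0 <= m ^+ 3 by exact: exprn_ge0.
have h4 : 0 <= M * m ^+ 2 by rewrite mulr_ge0// exprn_ge0.
nra.
Qed.

(** The inequality [2 * m ^ 2 <= a * m + m ^ 3 / a] for each generation; it is used
with [a] the square root of [n]. *)
Lemma square_le_cube_sum (a : R) n s : 0 < a -> (sumn s <= n)%N ->
  square_sum s <= (a * (sumn s)%:R + n%:R / a * cube_sum s) / 2 + cube_sum s.
Proof.
move=> a0; rewrite /cube_sum; elim: s => [|m [|z s] IH] sn.
- by rewrite /square_sum big_nil /=; lra.
- rewrite /square_sum big_seq1 /= lerDr divr_ge0// addr_ge0// ?mulr_ge0 ?exprn_ge0 ?invr_ge0//; exact: ltW.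
rewrite costE square_sum_cons; set C := cost _ _ _ in IH *.
have {}IH := IH (leq_trans (leq_addl m _) sn).
rewrite -[sumn (m :: _)]/(m + sumn (z :: s))%N in sn *.
set M := sumn _ in IH sn *.
apply: le_trans (lerD (lexx _) IH) _.
have [->|m0] := posnP m.
  by rewrite !expr0n /= mul0r !add0r add0n.
set N := (m + M)%N in sn *.
have N0 : 0 < N%:R :> R by rewrite ltr0n /N addn_gt0 m0.
have step : m%:R ^+ 2 <= (a * m%:R + n%:R / a * (m%:R ^+ 3 / N%:R)) / 2 :> R.
  have h1 : m%:R ^+ 3 / a <= n%:R / a * (m%:R ^+ 3 / N%:R) :> R.
    rewrite [X in _ <= X](_ : _ = n%:R / N%:R * m%:R ^+ 3 / a); last by field; rewrite !gt_eqF.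
    rewrite ler_wpM2r ?invr_ge0 ?(ltW a0)// ler_peMl ?exprn_ge0//.
    by rewrite ler_pdivlMr// mul1r ler_nat.
  rewrite ler_pdivlMr//; apply: le_trans (lerD (lexx _) h1).
  rewrite -subr_ge0 (_ : _ - _ = m%:R / a * (a - m%:R) ^+ 2).
    by rewrite mulr_ge0 ?sqr_ge0// divr_ge0// ltW.
  by field; rewrite gt_eqF.
have : 0 <= m%:R ^+ 3 / N%:R :> R by rewrite divr_ge0 ?exprn_ge0// ltW.
move=> h0; have -> : a * N%:R = a * m%:R + a * M%:R by rewrite -mulrDr -natrD.
move: h0 step; set u := m%:R ^+ 3 / _ => h0; set t := n%:R / a => step.
rewrite (_ : t * (u + C) = t * u + t * C); last exact: mulrDr.
move: h0 step; move: (t * u) (t * C) (a * M%:R) (a * m%:R) (m%:R ^+ 2 : R) => {IH} x1 x2 x3 x4 x5.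
clearbody u C => h0 step; lra.
Qed.

End chain_costs.

(** * Moments of the chain *)

Section chain_moments.
Variable R : realFieldType.

Let var (m M : nat) : R := M%:R * link_prob R m M.+1 * (1 - link_prob R m M.+1).

Lemma link_probE m M :
  link_prob R m M.+1 = m%:R / (m%:R + M%:R + 1) /\
  1 - link_prob R m M.+1 = (M%:R + 1) / (m%:R + M%:R + 1).
Proof.
have N0 : m%:R + M%:R + 1 != 0 :> R by rewrite -natrD natr1 pnatr_eq0.
have -> : link_prob R m M.+1 = m%:R / (m%:R + M%:R + 1).
  by rewrite /link_prob natrD -natr1 addrA.
by split => //; field.
Qed.

Lemma chain_second_moment m M c :
  binE M (link_prob R m M.+1) (fun i => (i.+1%:R + c) ^+ 2)
  = var m M + (1 + M%:R * link_prob R m M.+1 + c) ^+ 2.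
Proof.
set p := link_prob R m M.+1; set d := 1 + _ + c.
have [e1 e2 _ _] := binE_central M p.
transitivity (binE M p (fun i => (i%:R - M%:R * p) ^+ 2
   + (2 * d * (i%:R - M%:R * p) + d ^+ 2))).
  by apply: eq_binE => i _; rewrite /d -natr1; ring.
by rewrite !binED binEZ e1 e2 mulr0 add0r binE_cst.
Qed.

(** The drift of the size of the generations is at most [1 - a]: the term [a] keeps
them of the order of the square root of the number of vertices. *)
Lemma chain_drift m M : (0 < m)%N ->
  let a := m%:R ^+ 2 / (m + M.+1)%:R in let mu := M%:R * link_prob R m M.+1 in
  [/\ 0 <= var m M <= mu, 0 <= a <= m%:R, 0 <= mu <= m%:R - a
    & (mu - m%:R + 1) ^+ 2 <= 2 + 8 * (m%:R * a) ].
Proof.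
move=> m0 a mu; have := link_probE m M.
have -> : a = m%:R ^+ 2 / (m%:R + M%:R + 1) by rewrite /a natrD -natr1 addrA.
rewrite /mu /var {a mu}; move=> [-> ->].
have : 1 <= m%:R :> R by rewrite ler1n.
have : 0 <= M%:R :> R by [].
move: (m%:R : R) (M%:R : R) => {m0}x y y0 x1.
have N0 : 0 < x + y + 1 by lra.
have Nn0 : x + y + 1 != 0 by rewrite gt_eqF.
set q := x / (x + y + 1).
have q0 : 0 <= q by rewrite /q divr_ge0; lra.
have q1 : q <= 1 by rewrite /q ler_pdivrMr//; lra.
have -> : (y + 1) / (x + y + 1) = 1 - q by rewrite /q; field.
have -> : x ^+ 2 / (x + y + 1) = x * q by rewrite /q; field.
have yq : y * q = x - x * q - q by rewrite /q; field.
have yq0 : 0 <= y * q by exact: mulr_ge0.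
have xq0 : 0 <= x * q by apply: mulr_ge0 => //; lra.
split.
- by rewrite mulr_ge0 ?subr_ge0//= ler_piMr//; lra.
- by rewrite xq0 ler_piMr//; lra.
- by rewrite yq0 yq; lra.
rewrite yq (_ : _ - _ + 1 = 1 - q * (x + 1)); last by ring.
have h : q * (x + 1) <= 2 * (x * q) by nra.
have h2 : (x * q) ^+ 2 <= x * (x * q) by nra.
have : 0 <= q * (x + 1) by apply: mulr_ge0; lra.
nra.
Qed.

(** In mean, the square of the size of a generation grows by at most [3 * m + 1]
and decreases by [m ^ 3 / (m + M)]. The growth is paid by the [m] vertices that
leave the set of remaining vertices. *)
Lemma chainE_cube_sum f m M : (M <= f)%N -> (0 < m)%N ->
  chainE f m M (cube_sum R) <= m%:R ^+ 2 + 4 * (m + M)%:R.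
Proof.
apply: (chainE_cost_le (Phi := fun m M => m%:R ^+ 2 + 4 * (m + M)%:R)).
  by move=> k; rewrite lerDl mulr_ge0.
move=> {f m M}m M m0.
under eq_binE => i iM.
  rewrite addrA -[i.+1%:R]addr0 addSn subnKC//. over.
rewrite !binED !binE_cst chain_second_moment addr0.
have [/andP[v0 v1] /andP[a0 a1] /andP[mu0 mu1] _] := chain_drift M m0.
have -> : m%:R ^+ 3 / (m + M.+1)%:R = m%:R * (m%:R ^+ 2 / (m + M.+1)%:R) :> R.
  by rewrite exprS mulrA.
move: v0 v1 a0 a1 mu0 mu1; set a := _ / _; set mu := M%:R * _; set v := var m M.
rewrite natrD.
have : 1 <= m%:R :> R by rewrite ler1n.
move: (m%:R : R) (M.+1%:R : R) a mu v => x y a mu v x1 v0 v1 a0 a1 mu0 mu1.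
have : (1 + mu) ^+ 2 <= 1 + 2 * mu + (x - a) ^+ 2 by nra.
nra.
Qed.

(** A jump is the sum of its martingale part, of variance at most [m], and of its
drift, whose square is bounded by the decrease in the potential of
[chainE_cube_sum]. *)
Lemma chainE_jump_sum f m M : (M <= f)%N -> (0 < m)%N ->
  chainE f m M (jump_sum R) <= 8 * m%:R ^+ 2 + 35 * (m + M)%:R.
Proof.
apply: (chainE_cost_le (Phi := fun m M => 8 * m%:R ^+ 2 + 35 * (m + M)%:R)).
  by move=> k; rewrite addr_ge0// mulr_ge0// exprn_ge0.
move=> {f m M}m M m0.
under eq_binE => i iM.
  rewrite addrA -[X in 8 * X ^+ 2]addr0 addSn subnKC//. over.
rewrite !binED binEZ !binE_cst !chain_second_moment addr0.
have [/andP[v0 v1] /andP[a0 a1] /andP[mu0 mu1] d] := chain_drift M m0.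
move: v0 v1 a0 a1 mu0 mu1 d; set a := _ / _; set mu := M%:R * _; set v := var m M.
rewrite natrD.
have : 1 <= m%:R :> R by rewrite ler1n.
move: (m%:R : R) (M.+1%:R : R) a mu v => x y a mu v x1 v0 v1 a0 a1 mu0 mu1 d.
rewrite (_ : 1 + mu - x = mu - x + 1); last by ring.
have : (1 + mu) ^+ 2 <= 1 + 2 * mu + (x - a) ^+ 2 by nra.
nra.
Qed.

Lemma martingale_step m M i :
  let p := link_prob R m M.+1 in
  (m + M.+1)%:R * (i.+1%:R - 1) - (M.+1%:R - 1) * m%:R
  = (m + M.+1)%:R * (i%:R - M%:R * p) :> R.
Proof.
rewrite /= -[i.+1%:R]natr1 -[X in (X - 1) * _]natr1 !addrK mulrBr; congr (_ - _).
have N0 : (m + M.+1)%:R != 0 :> R by rewrite pnatr_eq0 addnS.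
by rewrite /link_prob mulrCA [_%:R * (_ / _)]mulrC divfK.
Qed.

Lemma variation_step m M :
  ((m + M.+1)%:R ^+ 2) * var m M = M.+1%:R * (M.+1%:R - 1) * m%:R.
Proof.
have [E1 E2] := link_probE m M; rewrite /var E2 E1 natrD -natr1; field.
by rewrite -natrD natr1 pnatr_eq0.
Qed.

(** The increments are centred given the past. *)
Lemma chainE_martingale_square f m M c : (M <= f)%N -> (0 < m)%N ->
  chainE f m M (fun s => (martingale R s + c) ^+ 2)
  = c ^+ 2 + chainE f m M (variation R).
Proof.
elim: f m M c => [|f IH] m [|M] c // Mf m0; rewrite ?chainE0 ?chainES.
1,2: by rewrite /martingale /variation /= add0r addr0.
set p := link_prob R m M.+1; set N := (m + M.+1)%:R : R.
have [e1 e2 _ _] := binE_central M p.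
transitivity (binE M p (fun i => N ^+ 2 * (i%:R - M%:R * p) ^+ 2
   + (2 * c * N * (i%:R - M%:R * p) + c ^+ 2) + chainE f i.+1 (M - i) (variation R))).
  apply: eq_binE => i iM.
  have Mif : (M - i <= f)%N by apply: leq_trans (leq_subr _ _) _.
  transitivity (chainE f i.+1 (M - i)
    (fun s => (martingale R s + (N * (i%:R - M%:R * p) + c)) ^+ 2)).
    apply: eq_chainE => // s ps; rewrite /martingale (@cost_cons _ _ _ m M.+1 i.+1 s)//.
    by rewrite martingale_step -/p -/N addrCA addrA.
  rewrite IH//; ring.
rewrite !binED !binEZ e1 e2 mulr0 add0r binE_cst.
rewrite -[M%:R * p * _]/(var m M) variation_step addrAC addrC; congr (_ + _).
transitivity (binE M p (fun i => M.+1%:R * (M.+1%:R - 1) * m%:R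
   + chainE f i.+1 (M - i) (variation R))).
  by rewrite binED binE_cst.
apply: eq_binE => i iM.
have Mif : (M - i <= f)%N by apply: leq_trans (leq_subr _ _) _.
rewrite -{1}(chainE_cst i.+1 (_ * _ * _) Mif) -chainED; apply: eq_chainE => // s ps.
by rewrite /variation (@cost_cons _ _ _ m M.+1 i.+1 s).
Qed.

End chain_moments.

(** * Trigonometric Taylor bounds *)

Section taylor_trig.
Variable R : realType.
Implicit Types (u b x : R).

(** Applied repeatedly, this yields the successive Taylor bounds below. *)
Lemma ge0_of_derive (f f' : R -> R) : (forall x, is_derive x 1 f (f' x)) ->
  (forall x, 0 <= x -> 0 <= f' x) -> f 0 = 0 -> forall x, 0 <= x -> 0 <= f x.
Proof.
move=> df f'0 f0 x x0.
have [|c] := MVT_segment x0 (fun y _ => df y).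
  apply: continuous_subspaceT => y; apply: differentiable_continuous.
  by apply/derivable1_diffP; have [] := df y.
rewrite in_itv /= f0 !subr0 => /andP[c0 _] ->.
by rewrite mulr_ge0// f'0.
Qed.

Let sin_le_id u : 0 <= u -> sin u <= u.
Proof.
move=> u0; rewrite -subr_ge0.
have d x : is_derive x 1 (fun u => u - sin u) (1 - cos x).
  by apply: is_derive_eq; rewrite /= /GRing.scale /=; lra.
apply: (ge0_of_derive d) u0 => [x x0|]; first by rewrite subr_ge0 cos_le1.
rewrite ?sin0 ?cos0 /=; lra.
Qed.

Let cos_ge2 u : 0 <= u -> 1 - u ^+ 2 / 2 <= cos u.
Proof.
move=> u0; rewrite -subr_ge0.
have d x : is_derive x 1 (fun u => cos u - (1 - u ^+ 2 / 2)) (x - sin x).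
  by apply: is_derive_eq; rewrite /= /GRing.scale /=; lra.
apply: (ge0_of_derive d) u0 => [x x0|]; first by rewrite subr_ge0 sin_le_id.
rewrite ?sin0 ?cos0 /=; lra.
Qed.

Let sin_ge3 u : 0 <= u -> u - u ^+ 3 / 6 <= sin u.
Proof.
move=> u0; rewrite -subr_ge0.
have d x : is_derive x 1 (fun u => sin u - (u - u ^+ 3 / 6))
    (cos x - (1 - x ^+ 2 / 2)).
  by apply: is_derive_eq; rewrite /= /GRing.scale /=; lra.
apply: (ge0_of_derive d) u0 => [x x0|]; first by rewrite subr_ge0 cos_ge2.
rewrite ?sin0 ?cos0 /=; lra.
Qed.

Let cos_le4 u : 0 <= u -> cos u <= 1 - u ^+ 2 / 2 + u ^+ 4 / 24.
Proof.
move=> u0; rewrite -subr_ge0.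
have d x : is_derive x 1 (fun u => 1 - u ^+ 2 / 2 + u ^+ 4 / 24 - cos u)
    (sin x - (x - x ^+ 3 / 6)).
  by apply: is_derive_eq; rewrite /= /GRing.scale /=; lra.
apply: (ge0_of_derive d) u0 => [x x0|]; first by rewrite subr_ge0 sin_ge3.
rewrite ?sin0 ?cos0 /=; lra.
Qed.

Let cos_ge1 u : 0 <= u -> 1 - u <= cos u.
Proof.
move=> u0; rewrite -subr_ge0.
have d x : is_derive x 1 (fun u => cos u - (1 - u)) (1 - sin x).
  by apply: is_derive_eq; rewrite /= /GRing.scale /=; lra.
apply: (ge0_of_derive d) u0 => [x x0|]; first by rewrite subr_ge0 sin_le1.
rewrite ?sin0 ?cos0 /=; lra.
Qed.

Let sin_ge2 u : 0 <= u -> u - u ^+ 2 / 2 <= sin u.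
Proof.
move=> u0; rewrite -subr_ge0.
have d x : is_derive x 1 (fun u => sin u - (u - u ^+ 2 / 2)) (cos x - (1 - x)).
  by apply: is_derive_eq; rewrite /= /GRing.scale /=; lra.
apply: (ge0_of_derive d) u0 => [x x0|]; first by rewrite subr_ge0 cos_ge1.
rewrite ?sin0 ?cos0 /=; lra.
Qed.

Let cos_le3 u : 0 <= u -> cos u <= 1 - u ^+ 2 / 2 + u ^+ 3 / 6.
Proof.
move=> u0; rewrite -subr_ge0.
have d x : is_derive x 1 (fun u => 1 - u ^+ 2 / 2 + u ^+ 3 / 6 - cos u)
    (sin x - (x - x ^+ 2 / 2)).
  by apply: is_derive_eq; rewrite /= /GRing.scale /=; lra.
apply: (ge0_of_derive d) u0 => [x x0|]; first by rewrite subr_ge0 sin_ge2.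
rewrite ?sin0 ?cos0 /=; lra.
Qed.

Let sin_le4 u : 0 <= u -> sin u <= u - u ^+ 3 / 6 + u ^+ 4 / 24.
Proof.
move=> u0; rewrite -subr_ge0.
have d x : is_derive x 1 (fun u => u - u ^+ 3 / 6 + u ^+ 4 / 24 - sin u)
    ((1 - x ^+ 2 / 2 + x ^+ 3 / 6) - cos x).
  by apply: is_derive_eq; rewrite /= /GRing.scale /=; lra.
apply: (ge0_of_derive d) u0 => [x x0|]; first by rewrite subr_ge0 cos_le3.
rewrite ?sin0 ?cos0 /=; lra.
Qed.

Lemma cos_taylor u : `|cos u - (1 - u ^+ 2 / 2)| <= u ^+ 4 / 24.
Proof.
wlog u0 : u / 0 <= u => [H|].
  case: (lerP 0 u) => [/H//|/ltW u0]; have := H (- u); rewrite oppr_ge0 => /(_ u0).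
  rewrite cosN (_ : (- u) ^+ 2 = u ^+ 2); last by ring.
  by rewrite (_ : (- u) ^+ 4 = u ^+ 4); last by ring.
have := cos_ge2 u0; have := cos_le4 u0; rewrite ler_norml => h1 h2.
have : 0 <= u ^+ 4 by exact: exprn_ge0.
lra.
Qed.

Lemma sin_taylor u : `|sin u - (u - u ^+ 3 / 6)| <= u ^+ 4 / 24.
Proof.
wlog u0 : u / 0 <= u => [H|].
  case: (lerP 0 u) => [/H//|/ltW u0]; have := H (- u); rewrite oppr_ge0 => /(_ u0).
  rewrite (_ : (- u) ^+ 4 = u ^+ 4); last by ring.
  rewrite sinN -normrN [X in `|X| <= _ -> _](_ : _ = sin u - (u - u ^+ 3 / 6)) //; field.
  by field.
have := sin_ge3 u0; have := sin_le4 u0; rewrite ler_norml; lra.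
Qed.

Lemma cosD_taylor b u :
  `|cos (b + u) - (cos b - sin b * u - cos b * u ^+ 2 / 2 + sin b * u ^+ 3 / 6)|
  <= u ^+ 4 / 12.
Proof.
have -> : cos (b + u) - (cos b - sin b * u - cos b * u ^+ 2 / 2 + sin b * u ^+ 3 / 6)
  = cos b * (cos u - (1 - u ^+ 2 / 2)) - sin b * (sin u - (u - u ^+ 3 / 6)).
  by rewrite cosD; field.
apply: le_trans (ler_normB _ _) _; rewrite !normrM.
have -> : u ^+ 4 / 12 = 1 * (u ^+ 4 / 24) + 1 * (u ^+ 4 / 24) by field.
by apply: lerD; apply: ler_pM => //;
  [exact: cos_max|exact: cos_taylor|exact: sin_max|exact: sin_taylor].
Qed.

Lemma expR_taylor u : 0 <= u -> 0 <= expR u * (expR (- u) - 1 + u) <= expR u * u ^+ 2.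
Proof.
move=> u0; have e0 := expR_ge0 u; have := expR_ge1Dx (- u) => h.
rewrite mulr_ge0//=; last by lra.
apply: ler_wpM2l => //.
have h1 : 1 <= expR (- u) * expR u by rewrite -expRD addNr expR0.
have h3 : expR (- u) * (1 + u) <= 1.
  by rewrite -[leRHS]expR0 -(addNr u) expRD ler_wpM2l ?expR_ge0 ?expR_ge1Dx.
have u1 : 0 < 1 + u by lra.
have u3 : 0 <= u ^+ 3 by exact: exprn_ge0.
rewrite -(ler_pM2r u1) mulrDl mulrBl.
have -> : u ^+ 2 * (1 + u) = u ^+ 2 + u ^+ 3 by ring.
lra.
Qed.

Lemma cos_lipschitz x y : `|cos x - cos y| <= `|x - y|.
Proof.
wlog xy : x y / x <= y => [H|].
  by have [/H//|/ltW/H] := leP x y; rewrite distrC [X in _ <= X -> _]distrC.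
have [|c _ E] := MVT_segment xy (fun z _ => is_derive_cos z).
  by apply: continuous_subspaceT => z; exact: continuous_cos.
by rewrite distrC E normrM normrN [leRHS]distrC ler_piMl// sin_max.
Qed.

End taylor_trig.

(** * The cosine of the martingale *)

Section chain_cosine.
Variable R : realType.
Implicit Types (t b : R).

(** In the Taylor expansion of the cosine at [b], the first order term has mean
zero and the second order one is compensated by [expR a]. *)
Lemma chain_cos_step n m M t b a : (0 < m)%N -> (m + M.+1 <= n)%N ->
  a = t ^+ 2 / 2 * (M.+1%:R * (M.+1%:R - 1) * m%:R) ->
  `|expR a * binE M (link_prob R m M.+1) (fun i => cos (b + t *
       ((m + M.+1)%:R * (i.+1%:R - 1) - (M.+1%:R - 1) * m%:R))) - cos b|
  <= expR a * (`|t * n%:R| ^+ 3 / 6 * m%:R + (t * n%:R) ^+ 4 * m%:R ^+ 2).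
Proof.
move=> m0 mn adef; set p := link_prob R m M.+1.
set N := (m + M.+1)%:R : R.
pose u (i : nat) := t * (N * (i%:R - M%:R * p)).
have -> : binE M p (fun i => cos (b + t * (N * (i.+1%:R - 1) - (M.+1%:R - 1) * m%:R)))
    = binE M p (fun i => cos (b + u i)).
  by apply: eq_binE => i _; rewrite martingale_step.
have [e1 e2 e3 e4] := binE_central M p.
set V := M%:R * p * (1 - p) in e2 e3 e4.
have aE : a = t ^+ 2 / 2 * (N ^+ 2 * V) by rewrite adef -variation_step.
have [/andP[V0 V1] /andP[c0 c1] /andP[mu0 mu1] _] := chain_drift R M m0.
rewrite -/p -/V in V0 V1 mu0 mu1.
have Vm : V <= m%:R by apply: le_trans V1 _; lra.
have m1 : 1 <= m%:R :> R by rewrite ler1n.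
have Nn : N <= n%:R by rewrite ler_nat.
have N0 : 0 <= N by [].
have p01 := link_prob01 R m M.+1; rewrite -/p in p01.
pose T i := cos b - sin b * u i - cos b * u i ^+ 2 / 2 + sin b * u i ^+ 3 / 6.
pose E3 := (t * N) ^+ 3 * (V * (1 - p - p)).
have ET : binE M p T = cos b * (1 - a) + sin b * E3 / 6.
  rewrite (@eq_binE _ _ _ _ (fun i => cos b + ((- (sin b * t * N)) * (i%:R - M%:R * p)
     + ((- (cos b / 2 * (t * N) ^+ 2)) * (i%:R - M%:R * p) ^+ 2
     + (sin b / 6 * (t * N) ^+ 3) * (i%:R - M%:R * p) ^+ 3)))).
    by rewrite !binED !binEZ binE_cst e1 e2 e3 aE /E3; field.
  by move=> i _; rewrite /T /u; field.
have d4 : `|binE M p (fun i => cos (b + u i)) - binE M p T|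
    <= (t * N) ^+ 4 * (3 * V ^+ 2 + V * (1 - 6 * (p * (1 - p)))) / 12.
  rewrite -[X in `|_ - X|]mul1r -mulNr -binEZ -binED.
  apply: le_trans (binE_norm _ _ p01) _.
  apply: (@le_trans _ _ (binE M p (fun i => (t * N) ^+ 4 / 12 * (i%:R - M%:R * p) ^+ 4))).
    apply: binE_le => // i _; rewrite mulN1r; apply: le_trans (cosD_taylor _ _) _.
    by rewrite le_eqVlt; apply/orP; left; apply/eqP; rewrite /u; field.
  by rewrite binEZ e4 le_eqVlt; apply/orP; left; apply/eqP; field.
have tN4 : (t * N) ^+ 4 <= (t * n%:R) ^+ 4.
  by rewrite !exprMn ler_wpM2l ?exprn_even_ge0// lerXn2r ?nnegrE.
have tN3 : `|t * N| ^+ 3 <= `|t * n%:R| ^+ 3.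
  by rewrite lerXn2r ?nnegrE// !normrM ler_wpM2l// !ger0_norm.
have [p0 p1] := andP p01.
have pq0 : 0 <= p * (1 - p) by rewrite mulr_ge0// subr_ge0.
have tN40 : 0 <= (t * N) ^+ 4 by rewrite exprn_even_ge0.
have V2 : V ^+ 2 <= m%:R ^+ 2 by rewrite lerXn2r ?nnegrE.
have d4' : (t * N) ^+ 4 * (3 * V ^+ 2 + V * (1 - 6 * (p * (1 - p)))) / 12
    <= (t * n%:R) ^+ 4 * (m%:R ^+ 2 / 3).
  have h : 3 * V ^+ 2 + V * (1 - 6 * (p * (1 - p))) <= 4 * m%:R ^+ 2.
    have : V * (1 - 6 * (p * (1 - p))) <= V by rewrite ler_piMr//; lra.
    have : m%:R <= m%:R ^+ 2 :> R by rewrite expr2 ler_peMr.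
    lra.
  have h' : 0 <= 3 * V ^+ 2 + V * (1 - 6 * (p * (1 - p))).
    rewrite -e4 -[X in X <= _](binE_cst M p); apply: binE_le => // i _.
    exact: exprn_even_ge0.
  rewrite (_ : _ * (m%:R ^+ 2 / 3) = (t * n%:R) ^+ 4 * (4 * m%:R ^+ 2) / 12); last by field.
  rewrite ler_wpM2r// ler_pM//.
have d3 : `|E3| <= `|t * n%:R| ^+ 3 * m%:R.
  rewrite /E3 normrM normrX ler_pM ?exprn_ge0// normrM (ger0_norm V0).
  rewrite -[leRHS]mulr1 ler_pM// ler_norml; lra.
have d2 : a ^+ 2 <= (t * n%:R) ^+ 4 * (m%:R ^+ 2 / 4).
  rewrite aE (_ : (_) ^+ 2 = (t * N) ^+ 4 * (V ^+ 2 / 4)); last by field.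
  by rewrite ler_pM// ?divr_ge0 ?exprn_ge0// ler_wpM2r.
have a0 : 0 <= a.
  by rewrite aE mulr_ge0 ?divr_ge0 ?sqr_ge0// mulr_ge0 ?sqr_ge0.
have := expR_taylor a0; set X := expR (- a) - 1 + a => /andP[X0 X1].
have ea : expR a * expR (- a) = 1 by rewrite -expRD addrN expR0.
rewrite (_ : _ - cos b = expR a * (binE M p (fun i => cos (b + u i)) - binE M p T)
   + expR a * (sin b * E3 / 6) - cos b * (expR a * X)); last first.
  have -> : expR a * X = 1 - expR a + expR a * a.
    by rewrite /X mulrDr mulrBr ea mulr1.
  by rewrite ET; ring.
apply: le_trans (ler_normB _ _) _; apply: le_trans (lerD (ler_normD _ _) (lexx _)) _.
have ep := expR_ge0 a.
rewrite (normrM (cos b)) (ger0_norm X0) !(normrM (expR a)) (ger0_norm ep).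
rewrite (normrM (sin b * E3)) (normrM (sin b)).
have h1 : `|sin b| * `|E3| * `|6^-1| <= `|t * n%:R| ^+ 3 * m%:R / 6.
  rewrite [`|6^-1|]ger0_norm// ler_wpM2r//; apply: le_trans d3.
  by rewrite ler_piMl// sin_max.
have h2 : `|cos b| * (expR a * X) <= expR a * a ^+ 2.
  by apply: le_trans X1; rewrite ler_piMl// cos_max.
rewrite -mulrDr; apply: le_trans (lerD (lexx _) h2) _; rewrite -mulrDr ler_wpM2l//.
apply: le_trans (lerD (lerD (le_trans d4 d4') h1) d2) _.
have : 0 <= (t * n%:R) ^+ 4 * m%:R ^+ 2 by rewrite mulr_ge0 ?exprn_even_ge0.
lra.
Qed.

(** The one-step error [alpha * m + beta * m ^ 2] is propagated to the first
generation with a factor at most the exponential of half the conditional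
variance accumulated meanwhile. *)
Lemma chain_cos n t f m M b : (M <= f)%N -> (0 < m)%N -> (m + M <= n)%N ->
  `|chainE f m M (fun s => expR (t ^+ 2 / 2 * variation R s)
                           * cos (b + t * martingale R s)) - cos b|
  <= expR (t ^+ 2 / 2 * n%:R ^+ 2 * (m + M)%:R)
     * chainE f m M (fun s => `|t * n%:R| ^+ 3 / 6 * (sumn s)%:R
                              + (t * n%:R) ^+ 4 * square_sum R s).
Proof.
set al := `|_| ^+ 3 / 6; set be := (_ * _) ^+ 4; set ka := _ * n%:R ^+ 2.
have al0 : 0 <= al by rewrite divr_ge0 ?exprn_ge0.
have be0 : 0 <= be by exact: exprn_even_ge0.
have ka0 : 0 <= ka by rewrite mulr_ge0 ?exprn_ge0// divr_ge0 ?sqr_ge0.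
have base m' b' : `|expR (t ^+ 2 / 2 * variation R [:: m'])
     * cos (b' + t * martingale R [:: m']) - cos b'|
   <= expR (ka * (m' + 0)%:R) * (al * (sumn [:: m'])%:R + be * square_sum R [:: m']).
  rewrite /variation /martingale /= !mulr0 expR0 mul1r addr0 subrr normr0.
  by rewrite mulr_ge0 ?expR_ge0// addr_ge0// mulr_ge0// square_sum_ge0.
elim: f m M b => [|f IH] m [|M] b // Mf m0 mn; rewrite ?chainE0 ?chainES; try exact: base.
set p := link_prob R m M.+1.
pose v : R := M.+1%:R * (M.+1%:R - 1) * m%:R.
pose a := t ^+ 2 / 2 * v.
pose D i : R := (m + M.+1)%:R * (i.+1%:R - 1) - (M.+1%:R - 1) * m%:R.
pose W s := al * (sumn s)%:R + be * square_sum R s.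
pose G i := chainE f i.+1 (M - i) (fun s => expR (t ^+ 2 / 2 * variation R s)
                           * cos ((b + t * D i) + t * martingale R s)).
pose H i := chainE f i.+1 (M - i) W.
have p01 := link_prob01 R m M.+1; rewrite -/p in p01.
have Mif i : (M - i <= f)%N by apply: leq_trans (leq_subr _ _) _.
have -> : binE M p (fun i => chainE f i.+1 (M - i) (fun s =>
    expR (t ^+ 2 / 2 * variation R (m :: s)) * cos (b + t * martingale R (m :: s))))
   = expR a * binE M p G.
  rewrite -binEZ; apply: eq_binE => i iM; rewrite /G -chainEZ; apply: eq_chainE => // s ps.
  rewrite /variation /martingale !(@cost_cons _ _ _ m M.+1 i.+1 s)//.
  by rewrite (mulrDr (t ^+ 2 / 2)) expRD -mulrA (mulrDr t) addrA.
have -> : binE M p (fun i => chainE f i.+1 (M - i) (fun s => W (m :: s)))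
   = al * m%:R + be * m%:R ^+ 2 + binE M p H.
  rewrite -[X in X + _](binE_cst M p) -binED; apply: eq_binE => i iM.
  rewrite /H -[X in X + _](chainE_cst i.+1 _ (Mif i)) -chainED; apply: eq_chainE => // s _.
  by rewrite /W square_sum_cons /= natrD; ring.
have step := @chain_cos_step n m M t b a m0 mn erefl; rewrite -/al -/be in step.
have aka : a <= ka * m%:R.
  rewrite /a /v /ka -[leRHS]mulrA ler_wpM2l ?divr_ge0 ?sqr_ge0// ler_wpM2r//.
  rewrite -natr1 addrK expr2 ler_pM// ?natr1 ler_nat; lia.
have GH : `|binE M p G - binE M p (fun i => cos (b + t * D i))|
    <= expR (ka * M.+1%:R) * binE M p H.
  rewrite -[X in `|_ - X|]mul1r -mulNr -binEZ -binED -binEZ.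
  apply: le_trans (binE_norm _ _ p01) _; apply: binE_le => // i iM; rewrite mulN1r.
  have := IH i.+1 (M - i)%N (b + t * D i) (Mif i) isT.
  by rewrite addSn subnKC//; apply; apply: leq_trans mn; rewrite leq_addl.
have H0 : 0 <= binE M p H.
  rewrite -[X in X <= _](binE_cst M p); apply: binE_le => // i iM.
  rewrite -[X in X <= _](chainE_cst i.+1 _ (Mif i)); apply: chainE_le => // s _.
  by rewrite addr_ge0// mulr_ge0// square_sum_ge0.
have q0 : 0 <= al * m%:R + be * m%:R ^+ 2 by rewrite addr_ge0// mulr_ge0// exprn_ge0.
rewrite (_ : _ - cos b = expR a * (binE M p G - binE M p (fun i => cos (b + t * D i)))
  + (expR a * binE M p (fun i => cos (b + t * D i)) - cos b)); last by ring.
apply: le_trans (ler_normD _ _) _; apply: le_trans (lerD (lexx _) step) _.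
rewrite normrM ger0_norm ?expR_ge0// -mulrDr (natrD R m M.+1) (mulrDr ka) expRD -(mulrA (expR _)).
apply: ler_pM; rewrite ?expR_ge0 ?ler_expR//; first by rewrite addr_ge0.
rewrite mulrDr addrC; apply: lerD; last exact: GH.
by rewrite ler_peMl// -expR0 ler_expR mulr_ge0.
Qed.

End chain_cosine.

(** * The normalised statistic of a path *)

Section profile_statistic.
Variable R : realType.
Implicit Types (t b : R).

(** The statistic of the theorem for a forest with profile [s], when [r] is the
square root of the number of vertices. *)
Definition path_stat (r : R) (s : seq nat) : R :=
  ((height_sum s)%:R / 2 - (square_sum R s - (sumn s)%:R)) / r ^+ 3.

Variables (n k : nat) (r B : R).
Hypothesis kn : (1 <= k <= n)%N.
Hypothesis r1 : 1 <= r.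
Hypothesis rn : r ^+ 2 = n%:R.
Hypothesis kB : k%:R ^+ 2 + 4 * n%:R <= B * n%:R.

Let L := chainE (R := R) (n - k) k (n - k).
Let k0 : (0 < k)%N. Proof. by case/andP: kn. Qed.
Let knE : (k + (n - k))%N = n. Proof. by rewrite subnKC//; case/andP: kn. Qed.
Let r0 : 0 < r. Proof. exact: lt_le_trans r1. Qed.
Let rn0 : r != 0. Proof. by rewrite gt_eqF. Qed.
Let n0 : 0 < n%:R :> R. Proof. by rewrite -rn exprn_gt0. Qed.
Let r3 : r ^+ 3 = r * n%:R. Proof. by rewrite -rn exprS. Qed.
Let B4 : 4 <= B.
Proof.
rewrite -(ler_pM2r n0); apply: le_trans kB; rewrite lerDr exprn_ge0//.
Qed.

Let LD Psi Phi : L (fun s => Psi s + Phi s) = L Psi + L Phi.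
Proof. exact: chainED. Qed.
Let LZ c Psi : L (fun s => c * Psi s) = c * L Psi.
Proof. exact: chainEZ. Qed.
Let Lcst c : L (fun=> c) = c.
Proof. exact: chainE_cst. Qed.
Let Lle Psi Phi : (forall s, chain_path k (n - k) s -> Psi s <= Phi s) ->
  L Psi <= L Phi.
Proof. exact: chainE_le. Qed.
Let Lnorm Psi : `|L Psi| <= L (fun s => `|Psi s|).
Proof. exact: chainE_norm. Qed.
Let pathn s : chain_path k (n - k) s -> sumn s = n.
Proof. by case/and3P => _ /eqP ->. Qed.

Let drift : R := (k%:R * (n%:R - k%:R)) / (2 * r ^+ 3).
Let rem s : R := (n%:R - 3 / 4 * k%:R ^+ 2 - last_square R s / 4 - jump_sum R s / 4) / r ^+ 3.

Lemma path_statE s : chain_path k (n - k) s ->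
  path_stat r s = - drift - martingale R s / (2 * r ^+ 3) + rem s.
Proof.
case: s => [|m s] /and3P[/eqP hk /eqP sn _]; first by move: k0; rewrite -hk.
rewrite /= in hk; have := height_square_sum R m s; rewrite /path_stat sn knE => H.
have sE : (sumn s)%:R = n%:R - k%:R :> R.
  by rewrite -knE -sn -hk /= !natrD addrC addKr.
rewrite opprB addrCA addrC H /rem /drift sE hk; field.
by rewrite rn0.
Qed.

Lemma mean_cube : L (cube_sum R) <= B * n%:R.
Proof. by apply: le_trans (chainE_cube_sum _ _ _) _; rewrite ?knE. Qed.

Lemma mean_jump : L (jump_sum R) <= 9 * B * n%:R.
Proof.
apply: le_trans (chainE_jump_sum _ _ _) _; rewrite ?knE//.
have : 4 * n%:R <= B * n%:R by rewrite ler_pM2r.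
have := n0; have := kB; have := n0; lra.
Qed.

Lemma last_square_le s : last_square R s <= cube_sum R s.
Proof.
rewrite /last_square /cube_sum; elim: s => [|m [|z s] IH]//; rewrite !costE add0r.
by apply: le_trans IH _; rewrite lerDr divr_ge0 ?exprn_ge0.
Qed.

Lemma last_square_ge0 s : 0 <= last_square R s.
Proof.
rewrite /last_square; elim: s => [|m [|z s] IH]//; rewrite ?costE ?add0r//=.
Qed.

Lemma jump_sum_ge0 s : 0 <= jump_sum R s.
Proof.
rewrite /jump_sum; elim: s => [|m [|z s] IH]//; rewrite costE addr_ge0// sqr_ge0 //.
Qed.

(** The choice [a = r] in [square_le_cube_sum] balances its two terms. *)
Lemma mean_square : L (square_sum R) <= 2 * B * r ^+ 3.
Proof.
apply: (@le_trans _ _ (L (fun s => (r * n%:R) / 2 + (n%:R / r / 2 + 1) * cube_sum R s))).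
  apply: Lle => s ps; have sn := pathn ps.
  apply: le_trans (square_le_cube_sum r0 (eq_leq sn)) _; rewrite sn.
  by rewrite le_eqVlt; apply/orP; left; apply/eqP; field.
rewrite LD Lcst LZ; have := mean_cube; set X := L _ => h.
have h1 : n%:R / r = r by rewrite -rn; field.
rewrite h1 r3; have h2 : (r / 2 + 1) * X <= (r / 2 + 1) * (B * n%:R).
  by rewrite ler_pM2l// addr_gt0 ?divr_gt0.
have h3 : B * n%:R <= r * (B * n%:R) by rewrite ler_peMl// mulr_ge0//; have := B4; lra.
have h4 : 4 * (r * n%:R) <= B * (r * n%:R) by rewrite ler_pM2r// mulr_gt0.
have h5 : 0 < r * n%:R by rewrite mulr_gt0.
rewrite mulrDl in h2; rewrite (mulrDl _ _ (B * _)) in h2.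
lra.
Qed.

Lemma mean_rem : L (fun s => `|rem s|) <= 12 * B / r.
Proof.
apply: (@le_trans _ _ (L (fun s => (n%:R + k%:R ^+ 2) / r ^+ 3 +
   ((r ^+ 3)^-1 * cube_sum R s + (r ^+ 3)^-1 * jump_sum R s)))).
  apply: Lle => s _; rewrite /rem normrM [`|_^-1|]ger0_norm ?invr_ge0 ?exprn_ge0 ?(ltW r0)//.
  rewrite -mulrDr (mulrC (r ^+ 3)^-1) -mulrDl ler_wpM2r ?invr_ge0 ?exprn_ge0 ?(ltW r0)//.
  have := last_square_le s; have := last_square_ge0 s; have := jump_sum_ge0 s.
  have : 0 <= k%:R ^+ 2 :> R by exact: exprn_ge0.
  by have := n0; rewrite ler_norml; move=> *; apply/andP; split; lra.
rewrite !LD Lcst !LZ.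
have h1 := mean_cube; have h2 := mean_jump.
have rp : 0 < (r ^+ 3)^-1 by rewrite invr_gt0 exprn_gt0.
have -> : 12 * B / r = (r ^+ 3)^-1 * (12 * B * n%:R) by rewrite -rn; field.
rewrite (mulrC (n%:R + _)) -!mulrDr ler_pM2l//.
have : 4 * n%:R <= B * n%:R by rewrite ler_pM2r.
have := kB; have := n0; lra.
Qed.

Let cmart : R := (2 * r ^+ 3)^-1.

Lemma drift_bounds : 0 <= drift <= B.
Proof.
have kr : k%:R <= n%:R :> R by rewrite ler_nat; case/andP: kn.
have k00 : 0 <= k%:R :> R by [].
rewrite /drift divr_ge0 ?mulr_ge0 ?subr_ge0 ?exprn_ge0 ?(ltW r0)//=.
rewrite ler_pdivrMr ?mulr_gt0 ?exprn_gt0// r3.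
have h1 : k%:R * r <= B * n%:R.
  have := sqr_ge0 (k%:R - r); rewrite sqrrB rn -mulr_natl.
  have := kB; have := n0; have := sqr_ge0 (k%:R : R); lra.
have h2 : k%:R * (n%:R - k%:R) <= k%:R * n%:R :> R.
  by rewrite ler_wpM2l// gerBl.
have h3 : k%:R * n%:R <= B * n%:R * r.
  have : k%:R * r * r <= B * n%:R * r by rewrite ler_wpM2r// ltW.
  by rewrite -mulrA -expr2 rn.
have h4 : 0 <= B * n%:R * r by rewrite !mulr_ge0//; have := B4; have := r1; lra.
lra.
Qed.

(** The martingale has second moment at most [n ^ 3 / 3]; this gives tightness. *)
Lemma mean_abs_stat : L (fun s => `|path_stat r s|) <= 14 * B.
Proof.
have [d0 d1] := andP drift_bounds.
have c0 : 0 <= cmart by rewrite invr_ge0 mulr_ge0 ?exprn_ge0 ?(ltW r0).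
apply: (@le_trans _ _ (L (fun s => (drift + 1) + (cmart ^+ 2 * (martingale R s + 0) ^+ 2 + `|rem s|)))).
  apply: Lle => s ps; rewrite (path_statE ps) addr0 -/cmart.
  have h : `|cmart * martingale R s| <= 1 + cmart ^+ 2 * martingale R s ^+ 2.
    rewrite -exprMn -real_normK ?num_real//; move: `|_| => y.
    have := sqr_ge0 (y - 1); have := sqr_ge0 y; rewrite !expr2; lra.
  apply: le_trans (ler_normD _ _) _; rewrite addrA lerD2r -addrA.
  apply: le_trans (ler_normB _ _) _; rewrite normrN (ger0_norm d0) lerD2l.
  by rewrite mulrC.
rewrite !LD !Lcst LZ; have -> : L (fun s => (martingale R s + 0) ^+ 2) = 0 ^+ 2 + L (variation R).
  exact: chainE_martingale_square.
rewrite expr0n /= add0r.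
have h : cmart ^+ 2 * L (variation R) <= 1.
  rewrite -LZ -[leRHS]Lcst; apply: Lle => s ps.
  have := variation_bounds R s; rewrite (pathn ps) => /andP[h _].
  rewrite /cmart exprVn mulrC ler_pdivrMr ?exprn_gt0 ?mulr_gt0 ?exprn_gt0// mul1r.
  have -> : (2 * r ^+ 3) ^+ 2 = 4 * n%:R ^+ 3 by rewrite -rn; ring.
  have : 0 <= variation R s by exact: variation_ge0.
  lra.
have := mean_rem; have : 12 * B / r <= 12 * B.
  by rewrite ler_pdivrMr// ler_peMr// mulr_ge0//; have := B4; lra.
have := B4; lra.
Qed.

(** The error comes from the remainder of [path_statE], from replacing the
conditional variance by its limit, and from [chain_cos]. *)
Lemma mean_cos_stat t b x :
  `|L (fun s => cos (b + t * path_stat r s)) - expR (- (t ^+ 2 / 24)) * cos (b - t * (x / 4))|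
  <= `|t| * `|drift - x / 4|
     + (`|t| * (12 * B) + expR (t ^+ 2 / 24) * t ^+ 2 * B
        + expR (t ^+ 2 / 8) * (`|t| ^+ 3 + t ^+ 4 * B)) / r.
Proof.
pose th := - (t * cmart); pose b' := b - t * drift.
pose V := variation R; pose M := martingale R.
have r0' := ltW r0.
have B0 : 0 <= B by have := B4; lra.
(* The cosine is 1-Lipschitz, so the remainder costs its mean absolute value. *)
have s1 : `|L (fun s => cos (b + t * path_stat r s)) - L (fun s => cos (b' + th * M s))|
    <= `|t| * (12 * B) / r.
  rewrite -[X in `|_ - X|]mul1r -mulNr -LZ -LD; apply: le_trans (Lnorm _) _.
  apply: (@le_trans _ _ (L (fun s => `|t| * `|rem s|))); last first.
    by rewrite LZ -mulrA ler_wpM2l// mean_rem.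
  apply: Lle => s ps; rewrite mulN1r; apply: le_trans (cos_lipschitz _ _) _.
  rewrite -normrM (path_statE ps) le_eqVlt; apply/orP; left; apply/eqP; congr `|_|.
  by rewrite /b' /th /cmart /M; ring.
(* Half the total conditional variance is below its limit t^2/24, by an amount
   controlled by the sum of squares. *)
have Vle s : chain_path k (n - k) s -> th ^+ 2 / 2 * V s <= t ^+ 2 / 24 <=
     th ^+ 2 / 2 * V s + t ^+ 2 / (3 * n%:R ^+ 2) * square_sum R s.
  move=> ps; have := variation_bounds R s; rewrite (pathn ps) -/V => /andP[h1 h2].
  have -> : th ^+ 2 / 2 * V s = t ^+ 2 / (24 * n%:R ^+ 3) * (3 * V s).
    by rewrite /th /cmart -rn; field; rewrite rn0.
  have nn0 : n%:R != 0 :> R by rewrite gt_eqF.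
  have t0 : 0 <= t ^+ 2 / (24 * n%:R ^+ 3) by rewrite divr_ge0 ?sqr_ge0.
  have -> : t ^+ 2 / 24 = t ^+ 2 / (24 * n%:R ^+ 3) * n%:R ^+ 3 by field.
  have -> : t ^+ 2 / (3 * n%:R ^+ 2) * square_sum R s
     = t ^+ 2 / (24 * n%:R ^+ 3) * (8 * n%:R * square_sum R s) by field.
  rewrite -mulrDr !ler_wpM2l//; apply: le_trans h2 _; rewrite lerD2l.
  by rewrite !ler_wpM2r ?square_sum_ge0// ler_nat.
have s2 : `|expR (t ^+ 2 / 24) * L (fun s => cos (b' + th * M s))
     - L (fun s => expR (th ^+ 2 / 2 * V s) * cos (b' + th * M s))|
    <= expR (t ^+ 2 / 24) * t ^+ 2 * B / r.
  rewrite -LZ -[X in `|_ - X|]mul1r -mulNr -LZ -LD; apply: le_trans (Lnorm _) _.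
  apply: (@le_trans _ _ (L (fun s => expR (t ^+ 2 / 24) * (t ^+ 2 / (3 * n%:R ^+ 2)) * square_sum R s))).
    apply: Lle => s ps; have /andP[h1 h2] := Vle s ps.
    rewrite mulN1r -mulrBl normrM; apply: (@le_trans _ _ `|expR (t ^+ 2 / 24) - expR (th ^+ 2 / 2 * V s)|).
      by rewrite ler_piMr// cos_max.
    rewrite ger0_norm ?subr_ge0 ?ler_expR//.
    set A := t ^+ 2 / 24 in h1 h2 *; set A' := th ^+ 2 / 2 * V s in h1 h2 *.
    have -> : expR A' = expR A * expR (A' - A) by rewrite -expRD addrC subrK.
    rewrite -{1}[expR A]mulr1 -mulrBr -mulrA ler_wpM2l ?expR_ge0//.
    by have := expR_ge1Dx (A' - A); lra.
  rewrite LZ -[leLHS]mulrA.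
  rewrite (_ : _ * B / r = expR (t ^+ 2 / 24) * (t ^+ 2 * (B / r))); last by ring.
  rewrite ler_wpM2l ?expR_ge0//.
  apply: (@le_trans _ _ (t ^+ 2 / (3 * n%:R ^+ 2) * (2 * B * r ^+ 3))).
    by rewrite ler_wpM2l ?mean_square// divr_ge0 ?sqr_ge0.
  have -> : t ^+ 2 / (3 * n%:R ^+ 2) * (2 * B * r ^+ 3) = t ^+ 2 * (B / r) * (2 / 3).
    by rewrite -rn; field.
  have : 0 <= t ^+ 2 * (B / r) by rewrite mulr_ge0 ?sqr_ge0// divr_ge0.
  lra.
have s3 : `|L (fun s => expR (th ^+ 2 / 2 * V s) * cos (b' + th * M s)) - cos b'|
    <= expR (t ^+ 2 / 8) * (`|t| ^+ 3 + t ^+ 4 * B) / r.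
  have := @chain_cos R n th (n - k) k (n - k) b' (leqnn _) k0; rewrite knE => /(_ (leqnn n)).
  move=> h; apply: le_trans h _.
  have -> : th ^+ 2 / 2 * n%:R ^+ 2 * n%:R = t ^+ 2 / 8.
    by rewrite /th /cmart -rn; field; rewrite rn0.
  rewrite -mulrA ler_wpM2l ?expR_ge0// -/L.
  have thn : `|th * n%:R| = `|t| / (2 * r).
    rewrite /th mulNr normrN (_ : t * cmart * n%:R = t / (2 * r)).
      by rewrite normrM [`|_^-1|]ger0_norm// invr_ge0 mulr_ge0.
    by rewrite /cmart -rn; field; rewrite rn0.
  have thn4 : (th * n%:R) ^+ 4 = t ^+ 4 / (16 * n%:R ^+ 2).
    by rewrite /th /cmart -rn; field; rewrite rn0.
  apply: (@le_trans _ _ (L (fun s => `|t| ^+ 3 / r / 48 + t ^+ 4 / (16 * n%:R ^+ 2) * square_sum R s))).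
    apply: Lle => s ps; rewrite (pathn ps) thn thn4 lerD2r le_eqVlt; apply/orP; left; apply/eqP.
    by rewrite -rn; field; rewrite rn0.
  rewrite LD Lcst LZ [leRHS]mulrDl.
  apply: lerD.
    have : 0 <= `|t| ^+ 3 / r by rewrite divr_ge0 ?exprn_ge0.
    lra.
  apply: (@le_trans _ _ (t ^+ 4 / (16 * n%:R ^+ 2) * (2 * B * r ^+ 3))).
    by rewrite ler_wpM2l ?mean_square// divr_ge0 ?exprn_even_ge0.
  have -> : t ^+ 4 / (16 * n%:R ^+ 2) * (2 * B * r ^+ 3) = t ^+ 4 * B / r / 8.
    by rewrite -rn; field.
  have : 0 <= t ^+ 4 * B / r by rewrite divr_ge0// mulr_ge0// exprn_even_ge0.
  lra.
have s4 : `|cos b' - cos (b - t * (x / 4))| <= `|t| * `|drift - x / 4|.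
  apply: le_trans (cos_lipschitz _ _) _; rewrite -normrM -normrN /b'.
  by rewrite le_eqVlt; apply/orP; left; apply/eqP; congr `|_|; ring.
set e := expR (- (t ^+ 2 / 24)).
have e0 : 0 <= e by exact: expR_ge0.
have e1 : e <= 1 by rewrite -expR0 ler_expR oppr_le0 divr_ge0 ?sqr_ge0.
have ee : e * expR (t ^+ 2 / 24) = 1 by rewrite -expRD addNr expR0.
set X := L (fun s => cos (b + _)) in s1 *; set Y := L (fun s => cos (b' + _)) in s1 s2 *.
set Z := L (fun s => _ * _) in s2 s3.
rewrite (_ : X - e * _ = (X - Y) + e * ((expR (t ^+ 2 / 24) * Y - Z) + (Z - cos b')
   + (cos b' - cos (b - t * (x / 4))))); last first.
  have EY : e * (expR (t ^+ 2 / 24) * Y) = Y by rewrite mulrA ee mul1r.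
  by rewrite -[in LHS](subrK Y X) -{2}EY; ring.
apply: le_trans (ler_normD _ _) _; rewrite normrM (ger0_norm e0).
set Q := _ + _ + _ in |- *.
have Qle : `|Q| <= expR (t ^+ 2 / 24) * t ^+ 2 * B / r
    + expR (t ^+ 2 / 8) * (`|t| ^+ 3 + t ^+ 4 * B) / r + `|t| * `|drift - x / 4|.
  apply: le_trans (ler_normD _ _) _; apply: lerD => //.
  by apply: le_trans (ler_normD _ _) _; apply: lerD.
have eQ : e * `|Q| <= `|Q| by rewrite ler_piMl.
rewrite !mulrDl; lra.
Qed.

End profile_statistic.

Local Open Scope classical_set_scope.
Local Open Scope ring_scope.

(** * Bernstein approximation *)

Section bernstein.
Variable R : realType.

Lemma heine_cantor (h : R -> R) (e : R) : continuous h -> 0 < e ->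
  exists2 d, 0 < d & forall x y, 0 <= x <= 1 -> `|x - y| < d -> `|h x - h y| <= e.
Proof.
move=> ch e0.
have : compact `[0 : R, 1] by exact: segment_compact.
move=> /compact_near_coveringP/(_ R (0 : R)^'+ (fun d x => forall y, `|x - y| < d -> `|h x - h y| <= e)).
move=> /(_ _)[].
  move=> x _; have /cvgrPdist_lt/(_ (e / 2)) := ch x; rewrite divr_gt0// => /(_ isT).
  move=> /nbhs_ballP[r /= r0 hr].
  exists (ball x (r / 2), [set d | d < r / 2]) => /=.
    split; first by apply: nbhsx_ballx; rewrite divr_gt0.
    by apply: nbhs_right_lt; rewrite divr_gt0.
  move=> [z d] /= [xz dr] y zy.
  have xz' : ball x r z by rewrite /ball /=; apply: lt_le_trans xz _; lra.
  have xy : ball x r y.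
    rewrite /ball /= -(subrKA z); apply: le_lt_trans (ler_normD _ _) _.
    by move: xz; rewrite /ball /=; lra.
  have := hr _ xz'; have := hr _ xy; rewrite /= => h1 h2.
  rewrite -(subrKA (h x)); apply: le_trans (ler_normD _ _) _.
  rewrite distrC; lra.
move=> d /= d0 H.
exists (d / 2); first by rewrite divr_gt0.
move=> x y x01; apply: (H (d / 2)).
- by rewrite /= sub0r normrN gtr0_norm ?divr_gt0//; lra.
- by rewrite divr_gt0.
- by rewrite /= in_itv.
Qed.

(** Chebyshev's inequality: the variance of a binomial proportion is at most
[1 / N], and [h] is uniformly continuous. *)
Lemma bernstein_approx (h : R -> R) (B e : R) : continuous h -> (forall x, `|h x| <= B) ->
  0 < e -> exists N, forall y, 0 <= y <= 1 ->
  `|h y - binE N y (fun i => h (i%:R / N%:R))| <= e.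
Proof.
move=> ch hB e0; have e2 : 0 < e / 2 by rewrite divr_gt0.
have [d d0 hd] := heine_cantor ch e2.
have B0 : 0 <= B by apply: le_trans (hB 0).
pose N := (Num.truncn (4 * B / (d ^+ 2 * e))).+1.
have NB : 4 * B / (d ^+ 2 * e) <= N%:R by apply: ltW; exact: truncnS_gt.
exists N => y y01.
have N0 : 0 < N%:R :> R by rewrite ltr0n.
have pt i : `|h y - h (i%:R / N%:R)| <= e / 2 + 2 * B / d ^+ 2 / N%:R ^+ 2 * (i%:R - N%:R * y) ^+ 2.
  have d2 : 0 < d ^+ 2 by rewrite exprn_gt0.
  have q0 : 0 <= 2 * B / d ^+ 2 / N%:R ^+ 2 * (i%:R - N%:R * y) ^+ 2.
    by rewrite mulr_ge0 ?sqr_ge0// !divr_ge0 ?sqr_ge0// ?mulr_ge0.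
  have [lt|ge] := ltP `|y - i%:R / N%:R| d; first by have := hd _ _ y01 lt; lra.
  apply: (@le_trans _ _ (2 * B)).
    by apply: le_trans (ler_normB _ _) _; have := hB y; have := hB (i%:R / N%:R); lra.
  have : d ^+ 2 <= (i%:R - N%:R * y) ^+ 2 / N%:R ^+ 2.
    have -> : (i%:R - N%:R * y) ^+ 2 / N%:R ^+ 2 = `|y - i%:R / N%:R| ^+ 2.
      by rewrite real_normK ?num_real//; field; rewrite gt_eqF.
    by rewrite lerXn2r ?nnegrE// ltW.
  move=> h1.
  have h2 : 2 * B / d ^+ 2 * d ^+ 2 <= 2 * B / d ^+ 2 * ((i%:R - N%:R * y) ^+ 2 / N%:R ^+ 2).
    by rewrite ler_wpM2l// divr_ge0 ?sqr_ge0// mulr_ge0.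
  rewrite divfK ?gt_eqF// in h2; apply: le_trans h2 _.
  rewrite mulrA (mulrAC _ (_ ^+ 2) (_^-1)); lra.
rewrite -[X in `|X - _|](binE_cst N y) -[X in `|_ - X|]mul1r -mulNr -binEZ -binED.
apply: le_trans (binE_norm _ _ y01) _.
apply: le_trans (binE_le y01 (fun i _ => _)) _.
  by move=> i _; rewrite mulN1r; exact: pt.
rewrite binED binE_cst binEZ; have [_ -> _ _] := binE_central N y.
have [y0 y1] := andP y01.
have : y * (1 - y) <= 1 by nra.
move=> yy.
have h3 : 2 * B / d ^+ 2 / N%:R ^+ 2 * (N%:R * y * (1 - y)) = (2 * B / d ^+ 2 / N%:R) * (y * (1 - y)).
  by field; rewrite !gt_eqF.
rewrite h3.
have h4 : 2 * B / d ^+ 2 / N%:R <= e / 2.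
  rewrite ler_pdivrMr// ler_pdivrMr ?exprn_gt0//.
  move: NB; rewrite ler_pdivrMr ?mulr_gt0 ?exprn_gt0//; lra.
have h5 : 0 <= 2 * B / d ^+ 2 / N%:R by rewrite !divr_ge0 ?sqr_ge0// mulr_ge0.
have : (2 * B / d ^+ 2 / N%:R) * (y * (1 - y)) <= (2 * B / d ^+ 2 / N%:R).
  by rewrite ler_piMr.
lra.
Qed.

End bernstein.

(** * Convergence tested on cosines *)

Section trigonometric_convergence.
Variable R : realType.
Implicit Types (f g : R -> R) (L : (R -> R) -> R).

(** Bounded continuous functions. *)
Definition Cb f := continuous f /\ exists B, forall x, `|f x| <= B.

(** What is common to integrals against a probability measure and to means along
the chain. Integrals being linear on integrable functions only, the axioms are
restricted to bounded continuous functions. *)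
Record mean L : Prop := Mean {
  meanD : forall f g, Cb f -> Cb g -> L (fun x => f x + g x) = L f + L g;
  meanZ : forall c f, Cb f -> L (fun x => c * f x) = c * L f;
  mean_le : forall f g, Cb f -> Cb g -> (forall x, f x <= g x) -> L f <= L g;
  mean1 : L (fun=> 1) = 1 }.

Lemma Cb_cst c : Cb (fun=> c).
Proof. by split; [move=> x; exact: cvg_cst|exists `|c|]. Qed.

Lemma CbD f g : Cb f -> Cb g -> Cb (fun x => f x + g x).
Proof.
move=> [cf [B fB]] [cg [C gC]]; split.
  by move=> x; apply: continuousD; [exact: cf|exact: cg].
by exists (B + C) => x; apply: le_trans (ler_normD _ _) _; exact: lerD.
Qed.

Lemma CbM f g : Cb f -> Cb g -> Cb (fun x => f x * g x).
Proof.
move=> [cf [B fB]] [cg [C gC]]; split.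
  by move=> x; apply: continuousM; [exact: cf|exact: cg].
by exists (B * C) => x; rewrite normrM ler_pM.
Qed.

Lemma CbZ c f : Cb f -> Cb (fun x => c * f x).
Proof. exact/CbM/Cb_cst. Qed.

Lemma Cb_norm f : Cb f -> Cb (fun x => `|f x|).
Proof.
move=> [cf [B fB]]; split; last by exists B => x; rewrite normr_id.
by move=> x; apply: continuous_comp; [exact: cf|exact: norm_continuous].
Qed.

Lemma Cb_cos a b : Cb (fun x => cos (a * x + b)).
Proof.
split; last by exists 1 => x; exact: cos_max.
move=> x; apply: (@continuous_comp _ _ _ (fun x => a * x + b) (@cos R)).
  by apply: continuousD; [apply: continuousM; [exact: cvg_cst|exact: cvg_id]|exact: cvg_cst].
exact: continuous_cos.
Qed.

Lemma mean_norm L f : mean L -> Cb f -> `|L f| <= L (fun x => `|f x|).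
Proof.
move=> mL cf; have cnf := Cb_norm cf.
rewrite ler_norml -[X in X <= _]mulN1r -(meanZ mL _ cnf); apply/andP; split.
  apply: mean_le => //; first exact: CbZ.
  by move=> x; rewrite mulN1r lerNl ler_normr lexx orbT.
by apply: mean_le => // x; exact: ler_norm.
Qed.

Lemma mean_cst L c : mean L -> L (fun=> c) = c.
Proof.
move=> mL; rewrite -[RHS]mulr1 -(mean1 mL) -(meanZ mL _ (Cb_cst 1)).
by congr L; apply/funext => x; rewrite mulr1.
Qed.

(** A continuous substitute, up to a constant, for the indicator of [|x| > A]. *)
Definition ramp (A x : R) : R := Num.min 1 (`|x| / A).

Lemma ramp_Cb A : 0 < A -> Cb (ramp A).
Proof.
move=> A0; split.
  move=> x; apply: (@continuous_min _ _ (cst 1) (fun x : R => `|x| / A)).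
    exact: cst_continuous.
  by apply: continuousM; [exact: norm_continuous|exact: cst_continuous].
exists 1 => x; rewrite ger0_norm /ramp ?ge_min ?lexx//.
by rewrite le_min ler01 divr_ge0// ltW.
Qed.

Variables (L : nat -> (R -> R) -> R) (L' : (R -> R) -> R).
Hypothesis mL : \forall n \near \oo, mean (L n).
Hypothesis mL' : mean L'.
Hypothesis Lcos : forall a b,
  L n (fun x => cos (a * x + b)) @[n --> \oo] --> L' (fun x => cos (a * x + b)).

Let good f := Cb f /\ L n f @[n --> \oo] --> L' f.

Let goodD f g : good f -> good g -> good (fun x => f x + g x).
Proof.
move=> [cf Lf] [cg Lg]; split; first exact: CbD.
rewrite meanD//; apply: cvg_trans; last exact: cvgD Lf Lg.
apply: near_eq_cvg.
by near=> n; rewrite meanD//; near: n.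
Unshelve. all: by end_near. Qed.

Let goodZ c f : good f -> good (fun x => c * f x).
Proof.
move=> [cf Lf]; split; first exact: CbZ.
rewrite meanZ//; apply: cvg_trans; last exact: cvgM (cvg_cst c) Lf.
apply: near_eq_cvg.
by near=> n; rewrite meanZ//; near: n.
Unshelve. all: by end_near. Qed.

Let good_cos a b : good (fun x => cos (a * x + b)).
Proof. by split; [exact: Cb_cos|exact: Lcos]. Qed.

Let good_ext f g : f =1 g -> good f -> good g.
Proof. by move=> /funext ->. Qed.

(** A product of a sine and a cosine is a sum of two sines, and a sine is a
cosine with phase shifted by [pi / 2]; this removes the sines one by one. *)
Let good_trig w i j a b : good (fun x => ((1 + sin (w * x)) / 2) ^+ i
  * (1 - (1 + sin (w * x)) / 2) ^+ j * cos (a * x + b)).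
Proof.
have prod (P u v : R) : P * (sin u * cos v)
    = 2^-1 * (P * cos (u + v - pi / 2)) + 2^-1 * (P * cos (u - v - pi / 2)).
  have cs z : cos (z - pi / 2) = sin z :> R by rewrite cosB cos_pihalf sin_pihalf mulr0 add0r mulr1.
  by rewrite !cs sinD sinB; field.
elim: i a b => [|i IHi] a b.
  elim: j a b => [|j IHj] a b.
    by apply: good_ext (good_cos a b) => x; rewrite !expr0 !mul1r.
  have := goodD (goodZ 2^-1 (IHj a b)) (goodZ (- 2^-1) (goodD
    (goodZ 2^-1 (IHj (w + a) (b - pi / 2))) (goodZ 2^-1 (IHj (w - a) (- b - pi / 2))))).
  apply: good_ext => x; set P := _ ^+ j in IHj *.
  rewrite !expr0 !mul1r (_ : (w + a) * x + (b - pi / 2) = w * x + (a * x + b) - pi / 2); last by ring.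
  rewrite (_ : (w - a) * x + (- b - pi / 2) = w * x - (a * x + b) - pi / 2); last by ring.
  by rewrite -prod exprS -/P; field.
have := goodD (goodZ 2^-1 (IHi a b)) (goodZ 2^-1 (goodD
    (goodZ 2^-1 (IHi (w + a) (b - pi / 2))) (goodZ 2^-1 (IHi (w - a) (- b - pi / 2))))).
apply: good_ext => x; set P := _ ^+ i * _ in IHi *.
rewrite (_ : (w + a) * x + (b - pi / 2) = w * x + (a * x + b) - pi / 2); last by ring.
rewrite (_ : (w - a) * x + (- b - pi / 2) = w * x - (a * x + b) - pi / 2); last by ring.
by rewrite -prod exprS /P; field.
Qed.

Let good_binE N w c : good (fun x => binE N ((1 + sin (w * x)) / 2) c).
Proof.
rewrite /binE; elim: (index_enum _) => [|i r IH].
  have := goodZ 0 (good_cos 0 0).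
  by apply: good_ext => x; rewrite big_nil mul0r.
apply: good_ext (goodD (goodZ ('C(N, i)%:R * c i) (good_trig w i (N - i) 0 0)) IH) => x.
by rewrite big_cons mul0r addr0 cos0; ring.
Qed.

Variable C : R.
Hypothesis tight : \forall n \near \oo, forall A, 0 < A -> L n (ramp A) <= C / A.
Hypothesis tight' : forall e, 0 < e -> exists A0, forall A, A0 <= A -> L' (ramp A) <= e.

(** A bounded continuous function agrees on a given interval with a continuous
function of [sin (w * x)], hence is there uniformly close to a trigonometric
polynomial that keeps the same bound everywhere. *)
Lemma trig_approx g (A B e : R) : continuous g -> (forall x, `|g x| <= B) -> 0 < A -> 0 < e ->
  exists2 f, good f & forall x, `|g x - f x| <= e + 2 * B * ramp A x.
Proof.
move=> cg gB A0 e0.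
have pi0 : 0 < pi :> R := pi_gt0 R.
(* With this frequency, w * x stays in a range on which the sine is invertible
   with inverse continuous up to the end points. *)
pose w := pi / 4 / A; have w0 : 0 < w by rewrite !divr_gt0.
pose s0 : R := sin (pi / 4).
have in4 (x : R) : `|x| <= A -> - (pi / 4) <= w * x <= pi / 4.
  move=> xA; have -> : w * x = pi / 4 * (x / A) by rewrite /w; field; rewrite gt_eqF.
  have p4 : 0 <= pi / 4 :> R by rewrite divr_ge0// ltW.
  rewrite -ler_norml normrM (ger0_norm p4) ler_piMr// normrM normfV (gtr0_norm A0).
  by rewrite ler_pdivrMr// mul1r.
have lesin (x y : R) : x \in `[(- (pi / 2)), (pi / 2)] -> y \in `[(- (pi / 2)), (pi / 2)] ->
    (sin x <= sin y) = (x <= y :> R).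
  by move=> xi yi; rewrite !leNgt ltr_sin.
have in2 (x : R) : - (pi / 4) <= x <= pi / 4 -> x \in `[(- (pi / 2)), (pi / 2)].
  by move=> /andP[h1 h2]; rewrite in_itv /=; apply/andP; split; lra.
have s01 : s0 < 1 by rewrite -sin_pihalf ltr_sin ?in_itv /=; lra.
have s00 : 0 < s0 by rewrite sin_gt0_pi//; apply/andP; split; lra.
(* Clamping makes h continuous everywhere. *)
pose cl y := Num.max (- s0) (Num.min s0 y).
have cl1 y : -1 < cl y < 1.
  by rewrite /cl lt_max gt_max gt_min s01 ltrN2 s01 /=; lra.
have clid x : `|x| <= A -> cl (sin (w * x)) = sin (w * x).
  move=> /in4 wx; have /andP[wx1 wx2] := wx.
  have p4 : - (pi / 4) <= (pi / 4 : R) <= pi / 4 by apply/andP; split; lra.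
  have n4 : - (pi / 4) <= - (pi / 4 : R) <= pi / 4 by apply/andP; split; lra.
  have h1 : sin (w * x) <= s0 by rewrite /s0 lesin// in2.
  have h2 : - s0 <= sin (w * x) by rewrite /s0 -sinN lesin// in2.
  by rewrite /cl min_r// max_r.
pose h y := g (asin (cl (2 * y - 1)) / w).
have ch : continuous h.
  move=> y; have -> : h = g \o (fun y : R => asin (cl (2 * y - 1)) / w) by [].
  apply: (@continuous_comp R R R); last exact: cg.
  apply: continuousM; last exact: cst_continuous.
  apply: (@continuous_comp R R R (fun y => cl (2 * y - 1)) (@asin R)); last exact: continuous_asin.
  have -> : (fun y => cl (2 * y - 1)) = cst (- s0) \max (cst s0 \min (fun y : R => 2 * y - 1)) by [].
  apply: continuous_max; first exact: cst_continuous.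
  apply: continuous_min; first exact: cst_continuous.
  apply: continuousB; last exact: cst_continuous.
  by apply: continuousM; [exact: cst_continuous|exact: cvg_id].
have hB y : `|h y| <= B by exact: gB.
have [N HN] := bernstein_approx ch hB e0.
pose p x := (1 + sin (w * x)) / 2.
have p01 x : 0 <= p x <= 1.
  by have := sin_le1 (w * x); have := sin_geN1 (w * x); rewrite /p => *; apply/andP; split; lra.
exists (fun x => binE N (p x) (fun i => h (i%:R / N%:R))); first exact: good_binE.
move=> x; have B0 : 0 <= B by apply: le_trans (gB 0).
have [xA|xA] := leP `|x| A; last first.
  have -> : ramp A x = 1 by apply/min_idPl; rewrite ler_pdivlMr// mul1r ltW.
  apply: le_trans (ler_normB _ _) _.
  have : `|binE N (p x) (fun i => h (i%:R / N%:R))| <= B.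
    apply: le_trans (binE_norm _ _ (p01 x)) _; rewrite -[leRHS](binE_cst N (p x)).
    by apply: binE_le => // i _; exact: hB.
  have := gB x; lra.
have -> : g x = h (p x).
  rewrite /h /p (_ : 2 * _ - 1 = sin (w * x)); last by field.
  by rewrite clid// sinK ?in2 ?in4// mulrC mulKf// gt_eqF.
apply: le_trans (HN _ (p01 x)) _; rewrite lerDl mulr_ge0 ?mulr_ge0//.
by rewrite le_min ler01 divr_ge0// ltW.
Qed.

(** The error of [trig_approx] is small in mean by tightness, uniformly in [n]. *)
Theorem cvg_mean_of_cos g : Cb g -> L n g @[n --> \oo] --> L' g.
Proof.
move=> [cg [B gB]]; apply/cvgrPdist_le => e e0.
have B0 : 0 <= B by apply: le_trans (gB 0).
pose e1 := e / 5; have e10 : 0 < e1 by rewrite divr_gt0.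
pose eB := e1 / (2 * B + 1); have eB0 : 0 < eB by rewrite divr_gt0//; lra.
have [A0 HA0] := tight' eB0.
pose A := Num.max 1 (Num.max A0 (C / eB)).
have Ap : 0 < A by rewrite lt_max ltr01.
have CA : C / A <= eB.
  by rewrite ler_pdivrMr// mulrC -ler_pdivrMr// !le_max lexx !orbT.
have eBe : 2 * B * eB <= e1.
  by rewrite /eB mulrA ler_pdivrMr; [nra|lra].
have [f [cf Lf] gf] := trig_approx cg gB Ap e10.
have cgb : Cb g by split => //; exists B.
have cr := ramp_Cb Ap.
have close (M : (R -> R) -> R) : mean M -> M (ramp A) <= eB -> `|M g - M f| <= 2 * e1.
  move=> mM Mr.
  have -> : M g - M f = M (fun x => g x + -1 * f x).
    by rewrite meanD ?meanZ ?mulN1r//; exact: CbZ.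
  have cgf : Cb (fun x => g x + -1 * f x) by apply: CbD => //; exact: CbZ.
  apply: le_trans (mean_norm mM cgf) _.
  apply: (@le_trans _ _ (M (fun x => e1 + 2 * B * ramp A x))).
    apply: mean_le => //; [exact: Cb_norm|apply: CbD; [exact: Cb_cst|exact: CbZ]|].
    by move=> x; rewrite mulN1r; exact: gf.
  rewrite (meanD mM (Cb_cst e1) (CbZ (2 * B) cr)) (meanZ mM _ cr) (mean_cst _ mM).
  have : 2 * B * M (ramp A) <= 2 * B * eB by rewrite ler_wpM2l// mulr_ge0.
  lra.
have HL' : `|L' g - L' f| <= 2 * e1.
  by apply: close => //; apply: HA0; rewrite !le_max lexx !orbT.
have /cvgrPdist_le/(_ _ e10) Hf := Lf.
have HtA : \forall n \near \oo, L n (ramp A) <= C / A.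
  by apply: filterS tight => n; exact.
near=> n.
have HLn : `|L n g - L n f| <= 2 * e1.
  apply: close; first by near: n.
  by apply: le_trans CA; near: n.
have Hfn : `|L' f - L n f| <= e1 by near: n.
rewrite -(subrKA (L' f)) -[X in _ + X](subrKA (L n f)).
apply: le_trans (ler_normD _ _) _; apply: le_trans (lerD (lexx _) (ler_normD _ _)) _.
rewrite [X in _ + (_ + X)]distrC /e1 in HLn HL' Hfn *; lra.
Unshelve. all: by end_near. Qed.

End trigonometric_convergence.

(** * The characteristic function of the normal law *)

Section normal_cosine.
Variables (R : realType) (m s : R).
Hypothesis s0 : 0 < s.
Local Notation mu := (@lebesgue_measure R).
Let sn0 : s != 0. Proof. by rewrite gt_eqF. Qed.

(** The density is the Radon-Nikodym derivative of the normal law. *)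
Lemma integral_normal_prob (f : R -> \bar R) :
  (normal_prob m s).-integrable setT f ->
  (\int[normal_prob m s]_x f x = \int[mu]_x (f x * (normal_pdf m s x)%:E))%E.
Proof.
move=> fi; have dom := normal_prob_dominates m s.
rewrite -(Radon_Nikodym_change_of_variables dom)//=.
have mf := measurable_int _ fi.
apply: ae_eq_integral => //.
- by apply: emeasurable_funM.
- apply: emeasurable_funM => //.
  by apply/measurable_EFinP; exact: measurable_normal_pdf.
- apply: ae_eqe_mul2l => /=.
  rewrite Radon_NikodymE//=.
  case: cid => /= h [h1 h2 h3].
  apply: integral_ae_eq => //=.
  + by apply/measurable_EFinP; exact: measurable_normal_pdf.
  + by move=> E E01 mE; rewrite -h3.
Qed.

Let s' := s * Num.sqrt 2.
Let s'0 : s' != 0. Proof. by rewrite mulf_neq0// gt_eqF// sqrtr_gt0. Qed.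
(* The factor s comes from |z| <= s * expR (z^2 / (4 s^2)). *)
Let c := s * normal_peak s / normal_peak s'.

(** A Gaussian factor of doubled variance absorbs the linear factor. *)
Lemma moment_normal_pdf_le x :
  `|x - m| * normal_pdf m s x <= c * normal_pdf m s' x.
Proof.
have s'2 : s' ^+ 2 = 2 * s ^+ 2 by rewrite exprMn sqr_sqrtr// mulrC.
have k0 := normal_peak_ge0 s; have k'0 := normal_peak_gt0 s'0.
rewrite !normal_pdfE//= /c /normal_fun.
rewrite (_ : s * _ / _ * (_ * _) = normal_peak s * (s * expR (- (x - m) ^+ 2 / (s' ^+ 2 *+ 2)))); last first.
  by field; rewrite gt_eqF.
rewrite mulrCA ler_wpM2l// s'2.
set q := (x - m) ^+ 2 / (4 * s ^+ 2).
have -> : - (x - m) ^+ 2 / (s ^+ 2 *+ 2) = - q + - q by rewrite /q -mulr_natl; field.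
have -> : - (x - m) ^+ 2 / ((2 * s ^+ 2) *+ 2) = - q by rewrite /q -mulr_natl; field.
rewrite expRD mulrA ler_wpM2r ?expR_ge0// expRN ler_pdivrMr ?expR_gt0//.
apply: (@le_trans _ _ (s * (1 + q))); last by rewrite ler_pM2l// expR_ge1Dx.
have -> : s * (1 + q) = s + `|x - m| ^+ 2 / (4 * s).
  by rewrite real_normK ?num_real// /q; field.
have -> : s + `|x - m| ^+ 2 / (4 * s) = `|x - m| + (`|x - m| - 2 * s) ^+ 2 / (4 * s) by field.
by rewrite lerDl divr_ge0 ?sqr_ge0// mulr_ge0// ltW.
Qed.

Lemma integrable_moment_normal_pdf :
  mu.-integrable setT (fun x => (`|x - m| * normal_pdf m s x)%:E).
Proof.
have : mu.-integrable setT (fun x => c%:E * (normal_pdf m s' x)%:E)%E.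
  by apply: integrableZl => //; exact: integrable_normal_pdf.
apply: le_integrable => //.
  apply/measurable_EFinP; apply: measurable_funM; last exact: measurable_normal_pdf.
  by apply: measurableT_comp => //; exact: measurable_funB.
move=> x _ /=; rewrite lee_fin.
rewrite [leLHS]ger0_norm ?mulr_ge0 ?normal_pdf_ge0 //.
exact: le_trans (moment_normal_pdf_le x) (ler_norm _).
Qed.

Lemma is_derive_normal_pdf (x : R) :
  is_derive x 1 (normal_pdf m s) (- (x - m) / s ^+ 2 * normal_pdf m s x).
Proof.
rewrite normal_pdfE// /normal_fun.
move: (normal_peak s) => k.
have du : is_derive x 1 (fun x : R => - (x - m) ^+ 2 / (s ^+ 2 *+ 2)) (- (x - m) / s ^+ 2).
  have -> : - (x - m) / s ^+ 2 = - (2 * (x - m)) * (s ^+ 2 *+ 2)^-1.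
    by rewrite -mulr_natl; field.
  move: (s ^+ 2 *+ 2)^-1 => K.
  by apply: is_derive_eq; rewrite /GRing.scale /=; ring.
have de := is_derive1_comp (f := expR) (g := fun x : R => - (x - m) ^+ 2 / (s ^+ 2 *+ 2)) (is_derive_expR _) du.
have := is_deriveZ k de.
rewrite (_ : k *: _ = - (x - m) / s ^+ 2 * (k * expR (- (x - m) ^+ 2 / (s ^+ 2 *+ 2)))) //.
by rewrite /GRing.scale /=; ring.
Qed.

(** The integral is the limit of those over [[- n, n]], by dominated convergence. *)
Lemma integral_derivative_line (G g : R -> R) :
  (forall x : R, is_derive x 1 G (g x)) -> continuous g ->
  mu.-integrable setT (EFin \o g) ->
  G n.+1%:R @[n --> \oo] --> 0 -> G (- n.+1%:R) @[n --> \oo] --> 0 ->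
  \int[mu]_x g x = 0.
Proof.
move=> dG cg ig Gy GNy.
have dcG : continuous G.
  move=> x; apply: differentiable_continuous.
  by apply/derivable1_diffP; have [] := dG x.
pose I n : set R := `[- n.+1%:R, n.+1%:R]%classic.
pose f_ n x := ((g x)%:E * (\1_(I n) x)%:E)%E.
have mI n : measurable (I n) by exact: measurable_itv.
have mg : measurable_fun setT g by exact: continuous_measurable_fun.
have cvgI : (\int[mu]_x f_ n x @[n --> \oo] --> \int[mu]_x (g x)%:E)%E.
  apply: (@dominated_cvg _ _ _ mu _ measurableT f_ _ (fun x => `|(g x)%:E|%E)) => //.
  - move=> n; apply: emeasurable_funM; first exact/measurable_EFinP.
    apply/measurable_EFinP; apply: measurable_indic; exact: mI.
  - move=> x _; apply: cvg_near_cst.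
    exists (Num.truncn `|x|) => // n /= hn; rewrite /f_ indicE mem_set ?mule1//.
    rewrite /I /= in_itv /= -ler_norml; apply: ltW; apply: lt_le_trans (truncnS_gt _) _.
    by rewrite ler_nat.
  - exact: integrable_abse.
  - move=> n x _; rewrite /f_ -EFinM lee_fin normrM ler_piMr//.
    by rewrite indicE; case: (_ \in _); rewrite ?normr1 ?normr0.
have FTC n : (\int[mu]_x f_ n x = (G n.+1%:R - G (- n.+1%:R))%:E)%E.
  transitivity (\int[mu]_(x in I n) (g x)%:E)%E.
    rewrite [RHS]integral_mkcond; apply: eq_integral => x _.
    by rewrite /f_ patchE indicE; case: (_ \in _); rewrite ?mule1 ?mule0.
  rewrite EFinB; apply: continuous_FTC2.
  - by rewrite gtrN.
  - exact: continuous_subspaceT.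
  - split.
    + by move=> x _; have [] := dG x.
    + by apply: cvg_at_right_filter; exact: dcG.
    + by apply: cvg_at_left_filter; exact: dcG.
  - by move=> x _; rewrite derive1E; have [_ ->] := dG x.
have cvg0 : (\int[mu]_x f_ n x @[n --> \oo] --> 0%:E)%E.
  have -> : (fun n => \int[mu]_x f_ n x)%E
      = (fun n => (G n.+1%:R - G (- n.+1%:R))%:E)%E by apply/funext.
  apply: cvg_EFin; first exact: nearW.
  rewrite -(subr0 (0 : R)); exact: cvgB.
by rewrite /Rintegral (cvg_unique _ cvgI cvg0).
Qed.

Variable ph : R.
Let f (t y : R) := cos (t * (y - m) + ph) * normal_pdf m s y.
Let df (t y : R) := - ((y - m) * sin (t * (y - m) + ph)) * normal_pdf m s y.
Let F t := \int[mu]_y f t y.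

Let continuous_pdf : continuous (normal_pdf m s).
Proof. exact: continuous_normal_pdf. Qed.

Let continuous_affine t : continuous (fun y : R => t * (y - m) + ph).
Proof.
move=> y; apply: (@continuousD _ _ _ (fun y : R => t * (y - m)) (cst ph)).
  apply: (@continuousM _ _ (cst t) (fun y : R => y - m)).
    exact: cst_continuous.
  apply: (@continuousB _ _ _ (fun y : R => y) (cst m)); first exact: cvg_id.
  exact: cst_continuous.
exact: cst_continuous.
Qed.

Let continuous_f t : continuous (f t).
Proof.
move=> y; apply: continuousM; last exact: continuous_pdf.
apply: (@continuous_comp R R R (fun y => t * (y - m) + ph) (@cos R)).
  exact: continuous_affine.
exact: continuous_cos.
Qed.

Let continuous_df t : continuous (df t).
Proof.
move=> y.
apply: (@continuousM _ _ (fun y : R => - ((y - m) * sin (t * (y - m) + ph))) (normal_pdf m s)).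
  apply: (@continuousN _ _ _ (fun y : R => (y - m) * sin (t * (y - m) + ph))).
  apply: (@continuousM _ _ (fun y : R => y - m) (fun y : R => sin (t * (y - m) + ph))).
    apply: (@continuousB _ _ _ (fun y : R => y) (cst m)); first exact: cvg_id.
    exact: cst_continuous.
  apply: (@continuous_comp R R R (fun y => t * (y - m) + ph) (@sin R)).
    exact: continuous_affine.
  exact: continuous_sin.
exact: continuous_pdf.
Qed.

Let integrable_f t : mu.-integrable setT (EFin \o f t).
Proof.
apply: (le_integrable _ _ _ (integrable_normal_pdf m s)) => //.
  by apply/measurable_EFinP; exact: continuous_measurable_fun.
move=> y _ /=; rewrite lee_fin /f normrM ler_piMl//; exact: cos_max.
Qed.

Let df_le t y : `|df t y| <= `|y - m| * normal_pdf m s y.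
Proof.
rewrite /df normrM normrN normrM (ger0_norm (normal_pdf_ge0 _ _ _)).
by rewrite ler_wpM2r ?normal_pdf_ge0// ler_piMr// sin_max.
Qed.

Let integrable_df t : mu.-integrable setT (EFin \o df t).
Proof.
apply: (le_integrable _ _ _ integrable_moment_normal_pdf) => //.
  by apply/measurable_EFinP; exact: continuous_measurable_fun.
move=> y _ /=; rewrite lee_fin; apply: le_trans (df_le t y) (ler_norm _).
Qed.

Let is_derive_f (t y : R) : is_derive t 1 (fun t : R => f t y) (df t y).
Proof.
rewrite /f /df; move: (normal_pdf m s y) (y - m) => p z.
by apply: is_derive_eq; rewrite /GRing.scale /=; ring.
Qed.

Let is_derive_F (t : R) : is_derive t 1 F (\int[mu]_y df t y).
Proof.
have ti : `]t - 1, t + 1[%classic t by rewrite /= in_itv /= ltrDl ltr01 gtrBl ltr01.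
have dE x y : partial1of2 f x y = df x y.
  by rewrite partial1of2E; have [_ ->] := is_derive_f x y.
have df' x y : `]t - 1, t + 1[%classic x -> setT y -> derivable (f ^~ y) x 1.
  by move=> _ _; have [] := is_derive_f x y.
have ub x y : `]t - 1, t + 1[%classic x -> setT y ->
    `|partial1of2 f x y| <= `|y - m| * normal_pdf m s y.
  by move=> _ _; rewrite dE; exact: df_le.
have ge0 y : 0 <= `|y - m| * normal_pdf m s y.
  by rewrite mulr_ge0// normal_pdf_ge0.
split.
  exact: (derivable_under_integral measurableT ti (fun x _ => integrable_f x)
    df' ge0 integrable_moment_normal_pdf ub).
rewrite -derive1E (differentiation_under_integral measurableT ti (fun x _ => integrable_f x)
    df' ge0 integrable_moment_normal_pdf ub).
by apply: eq_Rintegral => y _; exact: dE.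
Qed.

(** The density at [y] is [O(1 / |y - m|)] by [moment_normal_pdf_le]. *)
Let vanishing (G : R -> R) (u : nat -> R) : (forall y, `|G y| <= normal_pdf m s y) ->
  (forall n, n%:R <= `|u n|) -> G (u n) @[n --> \oo] --> 0.
Proof.
move=> Gp un; apply/cvgrPdist_le => e e0.
pose K := c * normal_peak s'.
have Kb y : `|y - m| * normal_pdf m s y <= K.
  apply: le_trans (moment_normal_pdf_le y) _; rewrite ler_wpM2l ?normal_pdf_ub//.
  by rewrite /c divr_ge0 ?mulr_ge0 ?normal_peak_ge0 ?(ltW s0).
exists (Num.truncn (`|m| + `|K / e| + 1)).+1 => // n /= hn.
have hn' : `|m| + `|K / e| + 1 <= n%:R.
  by apply/ltW; apply: lt_le_trans (truncnS_gt _) _; rewrite ler_nat.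
have h : `|K / e| + 1 <= `|u n - m|.
  have := lerB_normD (u n) (- m); rewrite normrN; have := un n; lra.
rewrite sub0r normrN; apply: le_trans (Gp _) _.
have p0 : 0 < `|u n - m| by apply: lt_le_trans h; rewrite ltr_wpDl.
rewrite -(ler_pM2l p0); apply: le_trans (Kb _) _.
have h1 : K / e <= `|u n - m| by apply: le_trans (ler_norm _) _; lra.
by rewrite -ler_pdivrMr.
Qed.

(** Stein's identity: integrate the derivative of [sin * normal_pdf]. *)
Let by_parts t : \int[mu]_y df t y = - (s ^+ 2 * t) * F t.
Proof.
pose G y := sin (t * (y - m) + ph) * normal_pdf m s y.
pose g y := t * f t y + (s ^+ 2)^-1 * df t y.
have Gp y : `|G y| <= normal_pdf m s y.
  rewrite /G normrM (ger0_norm (normal_pdf_ge0 _ _ _)).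
  by rewrite ler_piMl ?normal_pdf_ge0// sin_max.
have dG (x : R) : is_derive x 1 G (g x).
  have dp := is_derive_normal_pdf x.
  rewrite /G /g /f /df; move: (normal_pdf m s) dp => p dp.
  apply: is_derive_eq; rewrite /GRing.scale /=; field.
  exact: sn0.
have i1 : mu.-integrable setT (EFin \o (fun y => t * f t y)).
  have := integrableZl measurableT t (integrable_f t).
  by apply: eq_integrable => // y _ /=; rewrite EFinM.
have i2 : mu.-integrable setT (EFin \o (fun y => (s ^+ 2)^-1 * df t y)).
  have := integrableZl measurableT (s ^+ 2)^-1 (integrable_df t).
  by apply: eq_integrable => // y _ /=; rewrite EFinM.
have : \int[mu]_y g y = 0.
  apply: (integral_derivative_line dG).
  - move=> y; apply: (@continuousD _ _ _ (fun y => t * f t y) (fun y => (s ^+ 2)^-1 * df t y)).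
      apply: (@continuousM _ _ (cst t) (f t)); first exact: cst_continuous.
      exact: continuous_f.
    apply: (@continuousM _ _ (cst (s ^+ 2)^-1) (df t)); first exact: cst_continuous.
    exact: continuous_df.
  - have := integrableD measurableT i1 i2.
    by apply: eq_integrable => // y _ /=; rewrite EFinD.
  - by apply: vanishing => // n; rewrite ger0_norm// ler_nat.
  - by apply: vanishing => // n; rewrite normrN ger0_norm// ler_nat.
rewrite /g RintegralD// !RintegralZl// -/(F t) => /eqP.
rewrite addrC addr_eq0 => /eqP E.
have s20 : s ^+ 2 != 0 by rewrite expf_neq0.
by apply: (mulfI (invr_neq0 s20)); rewrite E; field.
Qed.

(** By differentiation under the integral and [by_parts], this function of [t] has
logarithmic derivative [- s ^ 2 * t]. *)
Lemma Rintegral_cos_normal_pdf t :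
  \int[mu]_y (cos (t * (y - m) + ph) * normal_pdf m s y)
  = cos ph * expR (- (s ^+ 2 * t ^+ 2 / 2)).
Proof.
rewrite -/(F t); pose H t := F t * expR (s ^+ 2 * t ^+ 2 / 2).
have dH (x : R) : is_derive x 1 H 0.
  have dF := is_derive_F x; rewrite by_parts in dF.
  rewrite /H; move: (s ^+ 2) F dF => v F' dF.
  by apply: is_derive_eq; rewrite /GRing.scale /=; field.
have : H t = H 0 by apply: is_derive_0_is_cst; exact: dH.
rewrite /H expr0n /= mulr0 mul0r expR0 mulr1.
have -> : F 0 = cos ph.
  rewrite /F /f; under eq_Rintegral do rewrite mul0r add0r.
  rewrite RintegralZl//; last exact: integrable_normal_pdf.
  by rewrite /Rintegral integral_normal_pdf mulr1.
by move=> <-; rewrite -(mulrA (F t)) -expRD addrN expR0 mulr1.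
Qed.

End normal_cosine.

(** * Uniform forests and the chain *)

Section uniform_forest.
Variables (R : realType) (n k : nat).
Hypothesis kn : (1 <= k <= n)%N.
Let k0 : (0 < k)%N. Proof. by case/andP: kn. Qed.
Let knE : (k + (n - k))%N = n. Proof. by rewrite subnKC//; case/andP: kn. Qed.
Let n0 : (0 < n)%N. Proof. by case/andP: kn => h; exact: leq_trans. Qed.

Let S := [set F : rooted_forest n | #|roots F| == k]%SET.

(** The normalising constant is the number of forests, obtained by summing the
constant function. *)
Lemma sum_uniform_forest (Psi : seq nat -> R) :
  #|S| != 0%N /\
  \sum_(F in S) Psi (profile F) = #|S|%:R * chainE (n - k) k (n - k) Psi.
Proof.
pose W : R := 'C(n, k)%:R * (k%:R * n%:R ^+ (n - k) / n%:R).
have main Psi' : \sum_(F in S) Psi' (profile F) = W * chainE (n - k) k (n - k) Psi'.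
  transitivity (\sum_(F : rooted_forest n | #|roots F| == k) Psi' (profile F)).
    by apply: eq_bigl => F; rewrite inE.
  rewrite sum_forests_profile// /W -[RHS]mulrA; congr (_ * _).
  have := gen_sum_chainE Psi' (leqnn (n - k)) k0; rewrite knE => E.
  have nn0 : n%:R != 0 :> R by rewrite pnatr_eq0 -lt0n.
  by apply: (mulIf nn0); rewrite E; field.
have SW : #|S|%:R = W.
  have := main (fun=> 1); rewrite chainE_cst// mulr1 => <-.
  by rewrite sumr_const.
split; last by rewrite SW main.
rewrite -(pnatr_eq0 R) SW /W mulf_neq0 ?pnatr_eq0 -?lt0n ?bin_gt0//; first by case/andP: kn.
by rewrite !mulf_neq0 ?invr_eq0 ?expf_neq0 ?pnatr_eq0 -?lt0n.
Qed.

Lemma height_cousin_statE (F : rooted_forest n) :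
  height_cousin_stat R F = path_stat (Num.sqrt n%:R) (profile F).
Proof.
have -> : height_cousin_stat R F = 1 / (2 * n%:R `^ (3 / 2)) * (\sum_(v < n) ht F v)%:R
    - 1 / (n%:R `^ (3 / 2)) * (\sum_(v < n) csn F v)%:R.
  by rewrite /height_cousin_stat !natr_sum.
rewrite sum_ht sum_csn /path_stat.
have -> : n%:R `^ (3 / 2) = Num.sqrt n%:R ^+ 3 :> R.
  rewrite -powR12_sqrt// -powR_mulrn ?powR_ge0// -powRrM; congr (_ `^ _).
  by rewrite mulrC.
have -> : (\sum_(m <- profile F) m * m.-1)%N%:R = square_sum R (profile F) - (sumn (profile F))%:R :> R.
  rewrite /square_sum sumnE natr_sum natr_sum -sumrB; apply: eq_bigr => -[|m] _.
    by rewrite mul0n expr0n subr0.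
  by rewrite /= natrM -[in RHS]natr1 -natr1; ring.
have : Num.sqrt n%:R ^+ 3 != 0 :> R by rewrite expf_neq0// gt_eqF// sqrtr_gt0 ltr0n.
by move: (_ ^+ 3) => z z0; field.
Qed.

Lemma expectation_uniform_forest d (T : measurableType d) (P : probability T R)
    (f : {RV P >-> rooted_forest n}) (g : R -> R) :
  uniformly_distributed f S ->
  ('E_P[g \o (@height_cousin_stat R n \o f)]
  = (chainE (n - k) k (n - k) (fun s => g (path_stat (Num.sqrt n%:R) s)))%:E)%E.
Proof.
move=> unif; pose h (F : rooted_forest n) := g (height_cousin_stat R F).
pose A F := f @^-1` [set F].
have mA F : measurable (A F) by apply: measurable_funPTI.
rewrite unlock.
transitivity (\int[P]_w (\sum_(F : rooted_forest n) (h F)%:E * (\1_(A F) w)%:E))%E.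
  apply: eq_integral => w _; rewrite (bigD1 (f w))//= big1.
    by rewrite adde0 indicE mem_set// mule1.
  move=> F Ff; rewrite indicE memNset ?mule0// /A /=; apply/eqP.
  by rewrite eq_sym.
rewrite integral_sum//; last first.
  move=> F; apply: integrableZl => //; exact: integrable_indic.
have iE F : (\int[P]_w ((h F)%:E * (\1_(A F) w)%:E) = (h F * (if F \in S then #|S|%:R^-1 else 0))%:E)%E.
  rewrite integralZl//; last exact: integrable_indic.
  rewrite integral_indic// setIT EFinM; congr (_ * _)%E.
  exact: unif.
under eq_bigr do rewrite iE.
rewrite sumEFin; congr (_%:E).
rewrite (bigID (mem S)) /= [X in _ + X]big1 ?addr0; last first.
  by move=> F /negbTE ->; rewrite mulr0.
rewrite (eq_bigr (fun F => #|S|%:R^-1 * g (path_stat (Num.sqrt n%:R) (profile F)))); last first.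
  by move=> F ->; rewrite mulrC /h height_cousin_statE.
have [S0 E] := sum_uniform_forest (fun s => g (path_stat (Num.sqrt n%:R) s)).
by rewrite -mulr_sumr E mulKf// pnatr_eq0.
Qed.

End uniform_forest.

(** * The limit theorem *)

Section probability_mean.
Variables (R : realType) (P : probability (measurableTypeR R) R).

Lemma integrable_Cb (f : R -> R) : Cb f -> P.-integrable setT (EFin \o f).
Proof.
move=> [cf [B fB]]; apply: measurable_bounded_integrable => //.
- exact: (le_lt_trans (probability_le1 P measurableT) (ltry 1)).
- exact: continuous_measurable_fun.
- exists B; split; first exact: num_real.
  by move=> y By x _; apply: le_trans (fB x) (ltW By).
Qed.

Lemma mean_Rintegral : mean (fun f : R -> R => \int[P]_x f x).
Proof.
split.
- by move=> f g cf cg; rewrite RintegralD//; exact: integrable_Cb.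
- by move=> c f cf; rewrite RintegralZl//; exact: integrable_Cb.
- by move=> f g cf cg fg; apply: le_Rintegral => //; exact: integrable_Cb.
- by rewrite Rintegral_cst// [X in fine X](probability_setT P) mul1r.
Qed.

(** By dominated convergence along integer values of [A], the ramp being
nonincreasing in [A]. *)
Lemma tight_Rintegral (e : R) : 0 < e -> exists A0, forall A, A0 <= A ->
  \int[P]_x ramp A x <= e.
Proof.
move=> e0.
have rC n : Cb (ramp (n.+1%:R : R)) by apply: ramp_Cb; rewrite ltr0n.
have : (\int[P]_x (ramp n.+1%:R x)%:E @[n --> \oo] --> \int[P]_x (0 : R)%:E)%E.
  apply: (@dominated_cvg _ _ _ P _ measurableT (fun n x => (ramp n.+1%:R x)%:E) _ (fun=> 1%:E)) => //.
  - by move=> n; apply/measurable_EFinP; apply: continuous_measurable_fun; have [] := rC n.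
  - move=> x _; apply: cvg_EFin; first exact: nearW.
    apply/cvgrPdist_le => d d0.
    exists (Num.truncn (`|x| / d)) => // n /= hn.
    have hn' : `|x| / d <= n.+1%:R.
      by apply/ltW; apply: lt_le_trans (truncnS_gt _) _; rewrite ler_nat.
    rewrite sub0r normrN ger0_norm; last by rewrite le_min ler01 divr_ge0.
    by rewrite ge_min; apply/orP; right; rewrite ler_pdivrMr ?ltr0n// mulrC -ler_pdivrMr.
  - exact: finite_measure_integrable_cst.
  - move=> n x _; rewrite lee_fin ger0_norm ?ge_min ?lexx//.
    by rewrite le_min ler01 divr_ge0.
rewrite integral0 => /fine_cvg/cvgrPdist_le/(_ _ e0)[n _ /(_ n (leqnn n))] /=.
rewrite sub0r normrN => h; exists n.+1%:R => A nA.
have A0 : 0 < A by apply: lt_le_trans nA; rewrite ltr0n.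
apply: (@le_trans _ _ (\int[P]_x ramp n.+1%:R x)); last exact: le_trans (ler_norm _) h.
apply: (mean_le mean_Rintegral) => //; first exact: ramp_Cb.
move=> x; rewrite /ramp le_min ge_min lexx /= ge_min; apply/orP; right.
by rewrite ler_wpM2l// lef_pV2// posrE ltr0n.
Qed.

End probability_mean.

Lemma mean_cos_normal_prob (R : realType) (m s a b : R) : 0 < s ->
  \int[normal_prob m s]_x cos (a * x + b)
  = cos (b + a * m) * expR (- (s ^+ 2 * a ^+ 2 / 2)).
Proof.
move=> s0; rewrite -(Rintegral_cos_normal_pdf m s0) /Rintegral.
rewrite integral_normal_prob//; last exact: integrable_Cb (Cb_cos a b).
congr fine; apply: eq_integral => x _; rewrite EFinM; congr (_%:E * _)%E.
by congr cos; ring.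
Qed.

Section normal_limit.
Variables (R : realType) (x : R) (k : nat -> nat).
Hypothesis hk : forall n, (1 <= n)%N -> (1 <= k n <= n)%N.
Hypothesis hkx : (2 * (k n)%:R / Num.sqrt (n%:R : R)) @[n --> \oo] --> x.

Let r n : R := Num.sqrt n%:R.
Let L n (g : R -> R) := chainE (n - k n) (k n) (n - k n) (fun s => g (path_stat (r n) s)).
Let B := 4 + (`|x| + 1) ^+ 2.

(** The regime in which the quantitative bounds on the chain apply. *)
Let bulk n : Prop := [/\ (1 <= k n <= n)%N, 1 <= r n, r n ^+ 2 = n%:R
  & (k n)%:R ^+ 2 + 4 * n%:R <= B * n%:R].

Let near_bulk : \forall n \near \oo, bulk n.
Proof.
have /cvgrPdist_le/(_ _ ltr01) h := hkx.
near=> n.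
have n1 : (1 <= n)%N by near: n; exact: nbhs_infty_ge.
have rn : r n ^+ 2 = n%:R by rewrite sqr_sqrtr.
have r1 : 1 <= r n by rewrite -sqrtr1 ler_wsqrtr// ler1n.
split => //; first exact: hk.
have : `|x - 2 * (k n)%:R / r n| <= 1 by near: n.
rewrite distrC => h1.
have h2 : 2 * (k n)%:R / r n <= `|x| + 1.
  have := ler_norm (2 * (k n)%:R / r n - x); have := ler_norm x; lra.
have r0 : 0 < r n by lra.
rewrite ler_pdivrMr// in h2.
have k0 : 0 <= (k n)%:R :> R by [].
rewrite /B (mulrDl 4) [leLHS]addrC lerD2l -rn -exprMn lerXn2r ?nnegrE//; first by rewrite mulr_ge0 ?addr_ge0// ltW.
lra.
Unshelve. all: by end_near. Qed.

Let inv_r : (r n)^-1 @[n --> \oo] --> 0.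
Proof.
apply/cvgrPdist_le => e e0.
exists (Num.truncn (e ^- 2)).+1 => // n /= hn.
have n0 : (0 < n)%N by apply: leq_trans hn.
have e2 : e ^- 2 <= n%:R by apply/ltW; apply: lt_le_trans (truncnS_gt _) _; rewrite ler_nat.
have r0 : 0 < r n by rewrite sqrtr_gt0 ltr0n.
rewrite sub0r normrN ger0_norm ?invr_ge0 ?(ltW r0)//.
rewrite -[leRHS]invrK lef_pV2 ?posrE ?invr_gt0//.
have <- : Num.sqrt (e ^- 2) = e^-1 by rewrite -exprVn sqrtr_sqr gtr0_norm ?invr_gt0.
exact: ler_wsqrtr.
Qed.

Let drift n : R := ((k n)%:R * (n%:R - (k n)%:R)) / (2 * r n ^+ 3).

Let cvg_drift : drift n @[n --> \oo] --> x / 4.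
Proof.
(* The drift is y / 4 - y^2 / (8 r) with y = 2 k / r tending to x. *)
have h : (2 * (k n)%:R / r n / 4 - (2 * (k n)%:R / r n) ^+ 2 / 8 * (r n)^-1)
    @[n --> \oo] --> x / 4 - x ^+ 2 / 8 * 0.
  apply: cvgB; first by apply: cvgM; [exact: hkx|exact: cvg_cst].
  apply: cvgM; last exact: inv_r.
  apply: cvgM; last exact: cvg_cst.
  by rewrite expr2; apply: cvgM; exact: hkx.
rewrite mulr0 subr0 in h; apply: cvg_trans h; apply: near_eq_cvg.
near=> n.
have [_ r1 rn _] : bulk n by near: n.
have rn0 : r n != 0 by rewrite gt_eqF//; lra.
by rewrite /drift -rn; field.
Unshelve. all: by end_near. Qed.

Let mean_L : \forall n \near \oo, mean (L n).
Proof.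
near=> n.
have [/andP[k0 _] _ _ _] : bulk n by near: n.
split.
- by move=> f g _ _; exact: chainED.
- by move=> c f _; exact: chainEZ.
- by move=> f g _ _ fg; apply: chainE_le => // s _; exact: fg.
- exact: chainE_cst.
Unshelve. all: by end_near. Qed.

Let nu : probability (measurableTypeR R) R := normal_prob (- (x / 4)) (Num.sqrt (1 / 12)).

Let cvg_cos a b : L n (fun y => cos (a * y + b)) @[n --> \oo]
  --> \int[nu]_y cos (a * y + b).
Proof.
have s0 : 0 < Num.sqrt (1 / 12) :> R by rewrite sqrtr_gt0 divr_gt0.
rewrite mean_cos_normal_prob// sqr_sqrtr ?divr_ge0//.
have -> : cos (b + a * - (x / 4)) * expR (- (1 / 12 * a ^+ 2 / 2))
    = expR (- (a ^+ 2 / 24)) * cos (b - a * (x / 4)).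
  by rewrite mulrC mulrN; congr (expR _ * _); field.
set l := _ * _.
pose C := `|a| * (12 * B) + expR (a ^+ 2 / 24) * a ^+ 2 * B
        + expR (a ^+ 2 / 8) * (`|a| ^+ 3 + a ^+ 4 * B).
have h : (`|a| * `|drift n - x / 4| + C * (r n)^-1) @[n --> \oo]
    --> `|a| * `|x / 4 - x / 4| + C * 0.
  apply: cvgD; apply: cvgM; try exact: cvg_cst; last exact: inv_r.
  by apply: cvg_norm; apply: cvgB; [exact: cvg_drift|exact: cvg_cst].
rewrite subrr normr0 !mulr0 addr0 in h.
apply/cvgrPdist_le => e e0; have /cvgrPdist_le/(_ _ e0) := h.
apply: filterS2 near_bulk => n [kn r1 rn kB]; rewrite sub0r normrN => le.
rewrite distrC.
have E : L n (fun y => cos (a * y + b))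
    = chainE (n - k n) (k n) (n - k n) (fun s => cos (b + a * path_stat (r n) s)).
  by congr chainE; apply/funext => s; rewrite addrC.
rewrite E; apply: le_trans (mean_cos_stat kn r1 rn kB a b x) _.
exact: le_trans (ler_norm _) le.
Qed.

Let tight_L : \forall n \near \oo, forall A, 0 < A -> L n (ramp A) <= 14 * B / A.
Proof.
near=> n => A A0.
have [kn r1 rn kB] : bulk n by near: n.
have k0 : (0 < k n)%N by case/andP: kn.
apply: (@le_trans _ _ (A^-1 * chainE (n - k n) (k n) (n - k n) (fun s => `|path_stat (r n) s|))).
  rewrite -chainEZ; apply: chainE_le => // s _.
  by rewrite /ramp ge_min [_ / A]mulrC lexx orbT.
rewrite [leRHS]mulrC; apply: ler_wpM2l; first by rewrite invr_ge0 ltW.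
exact: (mean_abs_stat kn r1 rn kB).
Unshelve. all: by end_near. Qed.

Lemma cvg_chain_normal (g : R -> R) : Cb g ->
  L n g @[n --> \oo] --> \int[nu]_y g y.
Proof.
apply: (cvg_mean_of_cos mean_L (mean_Rintegral nu) cvg_cos tight_L).
exact: tight_Rintegral.
Qed.

End normal_limit.

Theorem theorem1 (R : realType) (x : R) (hx : 0 <= x)
  (k : nat -> nat)
  (hk : forall n, (1 <= n)%N -> (1 <= k n <= n)%N)
  (hkx : (2 * (k n)%:R / Num.sqrt (n%:R : R)) @[n --> \oo] --> x)
  (d : nat -> measure_display) (T : forall n, measurableType (d n))
  (P : forall n, probability (T n) R)
  (f : forall n, {RV (P n) >-> rooted_forest n})
  (hf : forall n, (1 <= n)%N ->
    uniformly_distributed (f n) [set F : rooted_forest n | #|roots F| == k n]%SET) :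
  cvg_in_distribution
    (fun n => (@height_cousin_stat R n \o f n : {RV (P n) >-> R}))
    (normal_prob (- (x / 4)) (Num.sqrt (1 / 12))).
Proof.
move=> g cg [B [_ gB]].
have Cg : Cb g.
  by split => //; exists (B + 1) => y; apply: gB => //; rewrite ltrDl.
set nu := normal_prob _ _.
have -> : 'E_nu[g]%E = (\int[nu]_y g y)%:E.
  rewrite unlock /Rintegral fineK//; apply: integrable_fin_num => //.
  exact: integrable_Cb.
have h := cvg_chain_normal hk hkx Cg.
have : (chainE (n - k n) (k n) (n - k n)
    (fun s => g (path_stat (Num.sqrt n%:R) s)))%:E @[n --> \oo] --> (\int[nu]_y g y)%:E.
  by apply: cvg_EFin h; exact: nearW.
apply: cvg_trans; apply: near_eq_cvg; near=> n.
have n1 : (1 <= n)%N by near: n; exact: nbhs_infty_ge.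
exact/esym/(expectation_uniform_forest (hk n n1) g (hf n n1)).
Unshelve. all: by end_near. Qed.
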